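(* Let $\mu,k,n$ be positive integers such that $3\le k<n$ and such that: if $k=3$ then $n\ge 108$; if $k=4$ then $n\ge 54$; and if $k\ge 5$ then $n\ge 38$. Let $C=(m_1,\ldots,m_s)$ and $P=(n_1,\ldots,n_t)$ be two lists of integers such that $2\le m_i\le n$ for every $i\in\{1,\ldots,s\}$, $1\le n_i\le n-1$ for every $i\in\{1,\ldots,t\}$, and $$\sum_{i=1}^{s}m_i+\sum_{i=1}^{t}n_i=\mu\binom nk .$$ Then $\mu K_n^{(k)}$ has a decomposition into $s$ Berge cycles of lengths $m_1,\ldots,m_s$ and $t$ Berge paths of lengths $n_1,\ldots,n_t$.
   Context: A (multi-)hypergraph is a pair $(V,E)$ where $V$ is a finite set and $E$ is a family of subsets of $V$ (edges), in which an edge may be repeated; repeated copies count as distinct edges. The hypergraph $\mu K_n^{(k)}$ has a vertex set $V$ of size $n$, and each $k$-subset of $V$ appears exactly $\mu$ times as an edge, so it has $\mu\binom nk$ edges. A Berge path of length $\ell$ in a hypergraph $H$ is an alternating sequence $v_1,e_1,v_2,\ldots,v_\ell,e_\ell,v_{\ell+1}$ of distinct vertices $v_i$ and distinct edges $e_i$ of $H$ such that each $e_i$ contains $v_i$ and $v_{i+1}$. A Berge cycle of length $\ell$ in $H$ is an alternating sequence $v_1,e_1,v_2,\ldots,v_\ell,e_\ell$ of distinct vertices $v_i$ and distinct edges $e_i$ of $H$ such that each $e_i$ contains $v_i$ and $v_{i+1}$, where $v_{\ell+1}=v_1$. A decomposition of $\mu K_n^{(k)}$ into Berge cycles and paths is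 a family of Berge cycles and Berge paths in $\mu K_n^{(k)}$ whose edge sets are pairwise disjoint and whose union is the whole edge set of $\mu K_n^{(k)}$ (each copy of each $k$-set is used exactly once). Either of the lists $C$, $P$ may be empty ($s=0$ or $t=0$). *)

(* Defs.v *)
From mathcomp Require Import all_boot.

Set Implicit Arguments.
Unset Strict Implicit.
Unset Printing Implicit Defensive.

(* Edges are the elements of a finite index type; distinct indices may carry
   the same set of vertices, and are then distinct copies of that edge. *)
Record mhypergraph := MHypergraph {
  vertex : finType;
  edge : finType;
  ends : edge -> {set vertex}
}.

(* The pair (c, A) is the c-th copy of the k-subset A. *)
Definition complete_mhypergraph (mu n k : nat) : mhypergraph :=
  @MHypergraph 'I_n ('I_mu * {A : {set 'I_n} | #|A| == k})%type
    (fun e => val e.2).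

Section Berge.

Variable H : mhypergraph.

(* Indices start from 0: the i-th edge joins the vertices i and i.+1. *)
Record berge_path (l : nat) := BergePath {
  bp_vertex : 'I_l.+1 -> vertex H;
  bp_edge : 'I_l -> edge H;
  bp_vertex_inj : injective bp_vertex;
  bp_edge_inj : injective bp_edge;
  bp_left : forall i : 'I_l,
    bp_vertex (widen_ord (leqnSn l) i) \in ends (bp_edge i);
  bp_right : forall i : 'I_l,
    bp_vertex (lift ord0 i) \in ends (bp_edge i)
}.

(* ordS is the cyclic successor, so the last edge returns to the vertex 0. *)
Record berge_cycle (l : nat) := BergeCycle {
  bc_vertex : 'I_l -> vertex H;
  bc_edge : 'I_l -> edge H;
  bc_vertex_inj : injective bc_vertex;
  bc_edge_inj : injective bc_edge;
  bc_left : forall i : 'I_l, bc_vertex i \in ends (bc_edge i);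
  bc_right : forall i : 'I_l, bc_vertex (ordS i) \in ends (bc_edge i)
}.

Definition bp_edges (l : nat) (p : berge_path l) : {set edge H} :=
  [set bp_edge p i | i : 'I_l].

Definition bc_edges (l : nat) (c : berge_cycle l) : {set edge H} :=
  [set bc_edge c i | i : 'I_l].

Definition has_berge_decomposition (s t : nat)
    (C : s.-tuple nat) (P : t.-tuple nat) : Prop :=
  exists (c : forall i : 'I_s, berge_cycle (tnth C i))
         (p : forall j : 'I_t, berge_path (tnth P j)),
    let D (x : 'I_s + 'I_t) : {set edge H} :=
      match x with inl i => bc_edges (c i) | inr j => bp_edges (p j) end in
    (forall x y, x != y -> [disjoint D x & D y]) /\
    \bigcup_x D x = [set: edge H].

End Berge.

(* Main.v *)
Require Import Defs.
From mathcomp Require Import all_boot.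
From mathcomp Require Import all_order all_algebra perm zify ring.

Set Implicit Arguments.
Unset Strict Implicit.
Unset Printing Implicit Defensive.

(** Choose, for each cycle and path that is asked for, a sequence of distinct
    vertices.  Every pair of consecutive vertices (cyclically, for a cycle) is a
    slot, to be filled by a copy of a k-set that contains the pair.  There are as
    many slots as edges, so a decomposition along these sequences is a perfect
    matching between slots and edges.  By Hall's theorem (hall, proved here by
    Rado's argument) it exists as soon as every set F of pairs carries at most as
    many slots as there are edges containing a pair of F.  Two things remain: to
    choose the sequences so that the slots are spread evenly over the pairs, and
    to check Hall's condition for an even spread.

    Even spread.  Let w(xy) be the number of slots on the pair xy, and choose the
    sequences so that the sum of the squares w(xy)^2 is least.  Fix two vertices
    a and b.  In each sequence one may exchange a and b, and one may reverse the
    segment strictly between them; both moves change only pairs ac and bc, and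
    they keep the sums w(ac) + w(bc).  They split the contribution of the sequence
    to the vector of differences w(ac) - w(bc) into two integer vectors of l1-norm
    at most 2 whose signs can be flipped independently (switching).  If a sum of
    such vectors has a coordinate larger than 2 in absolute value, then flipping
    some of them shortens it (balancing), which would lower the sum of squares.
    So |w(ac) - w(bc)| <= 2 at the minimum, and going from one pair to any other
    in two steps shows that all values of w lie in an interval [q, q + 4]
    (balanced_placement).

    Hall's condition.  Let M be the set of pairs outside F; the k-sets without a
    pair in F are the k-cliques of the graph M.  As there are mu C(n,k) slots in
    all, it suffices that mu times the number of these cliques is at most q |M|,
    or that (q + 4) |F| is at most mu times the number of k-sets that F hits.
    For k = 3 the first holds when M is not nearly complete, because a graph with
    e edges has only of the order of e^(3/2) triangles; otherwise F is so
    small that few triples contain three pairs of F, and the second holds.  For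
    4 <= k <= n - 4 averaging reduces to k = 4, where the same alternative works
    with the bound e^2 / 6 on the number of 4-cliques.  For k = n - 2 and
    k = n - 3, one k-clique in M already forces F to be small compared with the
    k-sets that a single pair hits.  For k = n - 1 the average of w can be smaller
    than the error 4 and this method fails, but consecutive blocks of a cyclic
    list of all edges give the decomposition directly (decomposition_corank1). *)

(** * Shortening a sum of short integer vectors by sign changes *)

Section Balancing.
Import Order.TTheory GRing.Theory Num.Theory.
Local Open Scope ring_scope.
Variables (J V : finType) (v : J -> V -> int).
Implicit Types (f : {ffun J -> J}) (l : J) (c : V).

(** A function f labels the vectors; those with the same label l are to be flipped
    together, and act as the single vector block f l. *)
Definition block (f : {ffun J -> J}) (l : J) (c : V) : int :=
  \sum_(j | f j == l) v j c.

Definition light_blocks (f : {ffun J -> J}) : bool :=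
  [forall l, \sum_c `|block f l c| <= 2].

Definition merge (f : {ffun J -> J}) (l1 l2 : J) : {ffun J -> J} :=
  [ffun j => if f j == l2 then l1 else f j].

Lemma block_merge f l1 l2 l c : l1 != l2 ->
  block (merge f l1 l2) l c =
    if l == l2 then 0
    else if l == l1 then block f l1 c + block f l2 c else block f l c.
Proof.
move=> l12; rewrite /block.
case: (eqVneq l l2) => [->|l2N].
  rewrite big_pred0 // => j; rewrite ffunE.
  by case: (eqVneq (f j) l2) => [_|/negPf//]; apply: negPf.
case: (eqVneq l l1) => [->|l1N].
  rewrite (bigID (fun j => f j == l2)) /= addrC; congr (_ + _);
    apply: eq_bigl => j; rewrite ffunE;
    case: (eqVneq (f j) l2) => [fj|_]; rewrite ?eqxx ?andbT ?andbF //.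
  by rewrite fj eq_sym (negPf l12).
apply: eq_bigl => j; rewrite ffunE; case: (eqVneq (f j) l2) => [->|//].
by rewrite eq_sym (negPf l1N) eq_sym (negPf l2N).
Qed.

Lemma block_neq0 f l c : block f l c != 0 -> l \in f @: setT.
Proof.
apply: contraNT => /imsetP lN; rewrite /block big_pred0 // => j.
by apply/eqP => fj; apply: lN; exists j; rewrite ?inE.
Qed.

Lemma merge_fewer f l1 l2 : l1 != l2 -> l1 \in f @: setT -> l2 \in f @: setT ->
  (#|merge f l1 l2 @: setT| < #|f @: setT|)%N.
Proof.
move=> l12 l1f l2f; apply/proper_card/properP; split.
  by apply/subsetP => _ /imsetP[j _ ->]; rewrite ffunE; case: ifP => // _; apply: imset_f.
exists l2 => //; apply/imsetP => -[j _]; rewrite ffunE.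
by case: eqP => [_ e|fN e]; [rewrite e eqxx in l12 | apply: fN].
Qed.

(** Where two blocks have entries of opposite signs, adding them cancels at least 2
    of their total norm, which is at most 4, so the merged block is light again. *)
Lemma merge_light f l1 l2 c : l1 != l2 -> light_blocks f ->
  block f l1 c * block f l2 c < 0 -> light_blocks (merge f l1 l2).
Proof.
move=> l12 /forallP fL opp; apply/forallP => l.
under eq_bigr do rewrite block_merge //.
case: (l == l2); first by rewrite big1 // => *; rewrite normr0.
case: (l == l1); last exact: fL.
have: \sum_c `|block f l1 c + block f l2 c| + 2
   <= \sum_c (`|block f l1 c| + `|block f l2 c|).
  rewrite (bigD1 c) //= [leRHS](bigD1 c) //= addrAC lerD //.
    move: opp; move: (block f l1 c) (block f l2 c) => x y; nia.
  by apply: ler_sum => d _; apply: ler_normD.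
rewrite big_split /=; move: (fL l1) (fL l2).
move: (\sum_c `|block f l1 c|) (\sum_c `|block f l2 c|) => x y.
move: (\sum_c `|_|) => z. lia.
Qed.

Lemma sum_block f c : \sum_l block f l c = \sum_j v j c.
Proof. by rewrite [RHS](partition_big f predT). Qed.

(** Take a labelling into light blocks with as few blocks as possible.  No two blocks
    can be merged, so at each coordinate all blocks have the same sign.  A block u
    with a nonzero entry at c0 then satisfies |u c| <= |total c| everywhere, and
    |total c0| > 2 makes <u, total> exceed |u|^2; this is exactly the condition for
    flipping u to shorten the total. *)
Lemma balancing c0 :
  (forall j, \sum_c `|v j c| <= 2) -> 2 < `|\sum_j v j c0| ->
  exists X : {set J},
    \sum_c (\sum_(j in X) v j c) ^+ 2 <
    \sum_c (\sum_(j in X) v j c) * (\sum_j v j c).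
Proof.
move=> vL big.
have f0L : light_blocks [ffun j => j].
  apply/forallP => l; apply: le_trans (vL l); apply: ler_sum => c _.
  by rewrite /block (big_pred1 l) // => j; rewrite ffunE.
case: (arg_minnP (fun f : {ffun J -> J} => #|f @: setT|) f0L) => f fL fmin.
have same l1 l2 c : 0 <= block f l1 c * block f l2 c.
  rewrite leNgt; apply/negP => opp.
  have l12 : l1 != l2.
    by apply/eqP => e; move: opp; rewrite e -expr2 ltNge sqr_ge0.
  have := fmin _ (merge_light l12 fL opp).
  apply/negP; rewrite -ltnNge; apply: merge_fewer => //;
  by apply: (@block_neq0 f _ c); apply: contraTneq opp => ->; rewrite ?mul0r ?mulr0 ltxx.
have ge_sq l c : block f l c ^+ 2 <= block f l c * \sum_j v j c.
  rewrite -(sum_block f) mulr_sumr (bigD1 l) //= -expr2 lerDl.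
  by apply: sumr_ge0 => l' _; apply: same.
have [l lN] : exists l, block f l c0 != 0.
  apply/existsP; apply: contraTT big => /existsPn no.
  by rewrite -(sum_block f) big1 ?normr0 // => l _; apply/eqP/negbNE/no.
exists [set j | f j == l].
have E c : \sum_(j in [set j | f j == l]) v j c = block f l c.
  by apply: eq_bigl => j; rewrite inE.
under eq_bigr do rewrite E.
under [ltRHS]eq_bigr do rewrite E.
rewrite (bigD1 c0) //= [ltRHS](bigD1 c0) //=; apply: ltr_leD; last first.
  by apply: ler_sum => c _; apply: ge_sq.
have le2 : `|block f l c0| <= 2.
  apply: le_trans (forallP fL l); rewrite (bigD1 c0) //= lerDl.
  by apply: sumr_ge0.
move: le2 big lN (ge_sq l c0).
move: (block f l c0) (\sum_j v j c0) => x y; nia.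
Qed.
End Balancing.

(** * Sums along vertex sequences *)

Section Walks.
Import Order.TTheory GRing.Theory Num.Theory.
Local Open Scope ring_scope.
Variable V : finType.
Implicit Types (g : V -> V -> int) (a b c x y : V) (s P R S : seq V) (cl : bool).

Fixpoint walk_sum g x s : int :=
  if s is y :: s' then g x y + walk_sum g y s' else 0.

(** An item is a sequence of vertices together with a flag cl, which is true for a
    cycle; the closing pair is counted from the last vertex to the first.  A cycle
    of length 2 counts its only pair twice, as it should. *)
Definition item_sum g cl s : int :=
  if s is x :: s' then walk_sum g x s' + (if cl then g (last x s') x else 0)
  else 0.

Lemma walk_sum_cat g x s1 s2 :
  walk_sum g x (s1 ++ s2) = walk_sum g x s1 + walk_sum g (last x s1) s2.
Proof. by elim: s1 x => [|y s1 IH] x /=; rewrite ?add0r // IH addrA. Qed.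

Lemma walk_sum_rcons g x s y :
  walk_sum g x (rcons s y) = walk_sum g x s + g (last x s) y.
Proof. by rewrite -cats1 walk_sum_cat /= addr0. Qed.

Lemma walk_sum_rev g x s : (forall x y, g x y = g y x) ->
  walk_sum g (last x s) (rev (belast x s)) = walk_sum g x s.
Proof.
move=> gC; elim: s x => //= y s IH x; rewrite rev_cons walk_sum_rcons IH.
rewrite addrC gC; congr (g x _ + _).
by case: s {IH} => //= z s; rewrite rev_cons last_rcons.
Qed.

(** Reversal keeps all pairs inside the segment, so that only the two pairs joining
    the segment to a and b are replaced. *)
Lemma item_sum_rev_inner g cl R a p P b S : (forall x y, g x y = g y x) ->
  item_sum g cl (R ++ a :: rev (p :: P) ++ b :: S) =
  item_sum g cl (R ++ a :: (p :: P) ++ b :: S)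
    - (g a p + g (last p P) b - g a (last p P) - g p b).
Proof.
move=> gC.
have inner z : walk_sum g z (a :: rev (p :: P) ++ b :: S) =
  walk_sum g z (a :: (p :: P) ++ b :: S)
    - (g a p + g (last p P) b - g a (last p P) - g p b).
  have -> : rev (p :: P) = last p P :: rev (belast p P).
    by rewrite lastI rev_rcons.
  rewrite /= !walk_sum_cat /= walk_sum_rev //.
  have -> : last (last p P) (rev (belast p P)) = p.
    by case: P => //= q P; rewrite rev_cons last_rcons.
  ring.
have lastE z Q : last z (a :: Q ++ b :: S) = last b S.
  by rewrite -cat_cons last_cat.
case: R => [|z R].
  rewrite !cat0s /item_sum !last_cat; move: (inner a); rewrite /= => I.
  lia.
rewrite !cat_cons /item_sum !walk_sum_cat inner !last_cat !lastE (lastE _ (p :: P)).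
ring.
Qed.

Lemma item_sum_map g cl (t : V -> V) s :
  item_sum g cl (map t s) = item_sum (fun x y => g (t x) (t y)) cl s.
Proof.
have W x s' : walk_sum g (t x) (map t s') =
    walk_sum (fun x y => g (t x) (t y)) x s'.
  by elim: s' x => //= y s' IH x; rewrite IH.
by case: s => //= x s; rewrite W last_map.
Qed.

Lemma item_sum_le g1 g2 cl s : (forall x y, g1 x y <= g2 x y) ->
  item_sum g1 cl s <= item_sum g2 cl s.
Proof.
move=> le12; case: s => //= x s; apply: lerD; last by case: cl.
by elim: s x => //= y s IH x; apply: lerD.
Qed.

Lemma eq_item_sum g1 g2 cl s : (forall x y, g1 x y = g2 x y) ->
  item_sum g1 cl s = item_sum g2 cl s.
Proof. by move=> E; apply/eqP; rewrite eq_le !item_sum_le // => x y; rewrite E. Qed.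

Lemma item_sum0 cl s : item_sum (fun _ _ => 0) cl s = 0.
Proof.
case: s => //= x s; rewrite [walk_sum _ _ _](_ : _ = 0); first by case: cl.
by elim: s x => //= y s IH x; rewrite IH.
Qed.

Lemma item_sum_sum (I : finType) (A : pred I) (G : I -> V -> V -> int) cl s :
  \sum_(i | A i) item_sum (G i) cl s =
  item_sum (fun x y => \sum_(i | A i) G i x y) cl s.
Proof.
case: s => [|x s] /=; first by rewrite big1.
rewrite big_split /=; congr (_ + _); last by case: cl => //; rewrite big1.
elim: s x => [|y s IH] x /=; first by rewrite big1.
by rewrite big_split /= IH.
Qed.

Definition joins x y (u v : V) : int :=
  ((u == x) && (v == y))%:R + ((u == y) && (v == x))%:R.

Definition mult cl s x y : int := item_sum (joins x y) cl s.

Lemma joins_sym x y u v : joins x y u v = joins x y v u.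
Proof. by rewrite /joins addrC [(v == x) && _]andbC [(v == y) && _]andbC. Qed.

Lemma joinsC x y u v : joins x y u v = joins y x u v.
Proof. by rewrite /joins addrC. Qed.

Lemma joins_ge0 x y u v : 0 <= joins x y u v.
Proof. by rewrite addr_ge0 ?ler0n. Qed.

Lemma multC cl s x y : mult cl s x y = mult cl s y x.
Proof. by apply: eq_item_sum => u v; apply: joinsC. Qed.

Lemma mult_ge0 cl s x y : 0 <= mult cl s x y.
Proof. by rewrite -(item_sum0 cl s); apply: item_sum_le => u v; apply: joins_ge0. Qed.

(** In a sequence without repetition a vertex has at most two neighbours; the sum of
    the endpoint indicators over all pairs is 2 for an occurrence of a, except that
    the ends of a path count once. *)
Lemma degree_le2 cl s a : uniq s -> \sum_(c | c != a) mult cl s a c <= 2.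
Proof.
move=> us; rewrite item_sum_sum.
apply: (@le_trans _ _ (item_sum (fun u v => (u == a)%:R + (v == a)%:R) cl s)).
  apply: item_sum_le => u v; rewrite /joins big_split /=; apply: lerD.
    case: (u == a) => /=; last by rewrite big1.
    case: (eqVneq v a) => [->|va].
      by rewrite big1 // => c /negPf; rewrite eq_sym => ->.
    by rewrite (bigD1 v) //= eqxx big1 // => c /andP[_ /negPf]; rewrite eq_sym => ->.
  case: (v == a) => /=; last by rewrite big1 // => c _; rewrite andbF.
  case: (eqVneq u a) => [->|va].
    by rewrite big1 // => c /negPf; rewrite eq_sym => ->.
  rewrite (bigD1 u) //= eqxx big1 // => c /andP[_ /negPf]; rewrite eq_sym => -> //.
case: s us => [//|x s] us.
have W z s' : walk_sum (fun u v => (u == a)%:R + (v == a)%:R) z s' =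
   (count_mem a (z :: s'))%:R *+ 2 - (z == a)%:R - (last z s' == a)%:R.
  elim: s' z => [|y s' IH] z /=; first by rewrite addn0; case: (z == a).
  by rewrite IH /= !natrD; case: (z == a); case: (y == a); lia.
rewrite /item_sum W.
have : (count_mem a (x :: s) <= 1)%N by rewrite count_uniq_mem // leq_b1.
by move: (count_mem _ _) => k; case: cl (x == a) (last x s == a) => -[] [];  lia.
Qed.

Lemma mult_adj cl R u v S : u != v -> 1 <= mult cl (R ++ u :: v :: S) u v.
Proof.
move=> uv; rewrite /mult.
have W z s : 0 <= walk_sum (joins u v) z s.
  by elim: s z => //= y s IH z; rewrite addr_ge0 // joins_ge0.
have C (z z' : V) : 0 <= (if cl then joins u v z z' else 0).
  by case: cl => //; apply: joins_ge0.
have A z : 1 <= walk_sum (joins u v) z (u :: v :: S).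
  rewrite /= {2}/joins !eqxx (negPf uv) /= addr0.
  by rewrite addrCA lerDl addr_ge0 ?joins_ge0.
case: R => [|z R].
  move: (A u) (C (last u (v :: S)) u); rewrite /= {1}/joins (negPf uv) andbF /= add0r.
  by move=> A1 C1; rewrite -[1]addr0 lerD.
rewrite cat_cons /item_sum walk_sum_cat -[1]addr0 lerD //.
by rewrite -[1]add0r lerD.
Qed.
End Walks.

(** * Switching two vertices in a sequence *)

Section Switching.
Import Order.TTheory GRing.Theory Num.Theory.
Local Open Scope ring_scope.
Variable V : finType.
Implicit Types (a b c x y : V) (s P R S : seq V) (cl : bool) (v w : V -> int).

Lemma sum_delta (A : pred V) x : A x -> \sum_(c | A c) (c == x)%:R = 1 :> int.
Proof.
move=> Ax; rewrite (bigD1 x) //= eqxx big1 ?addr0 //.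
by move=> c /andP[_ /negPf->].
Qed.

(** Moving v c units of multiplicity from the pair ac to the pair bc, for all c at
    once, subtracts skew a b v from the multiplicities. *)
Definition skew a b v x y : int :=
  (x == a)%:R * v y + (y == a)%:R * v x - (x == b)%:R * v y - (y == b)%:R * v x.

Definition imbalance cl s a b c : int :=
  if (c == a) || (c == b) then 0 else mult cl s a c - mult cl s b c.

Definition off a b v := (v a = 0) /\ (v b = 0).

Lemma imbalance_off cl s a b : off a b (imbalance cl s a b).
Proof. by rewrite /off /imbalance !eqxx orbT. Qed.

Lemma mult_notin cl s a c : a \notin s -> mult cl s a c = 0.
Proof.
have W z s' : a \notin z :: s' -> walk_sum (joins a c) z s' = 0.
  elim: s' z => //= y s' IH z; rewrite !inE !negb_or => /and3P[za ya s'a].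
  rewrite IH ?inE ?negb_or ?ya // /joins eq_sym (negPf za) eq_sym.
  by rewrite [y == a]eq_sym (negPf ya) andbF.
case: s => [//|x s] xs; rewrite /mult /= W //.
case: cl => //; rewrite /joins.
have -> : (x == a) = false by apply: contraNF xs => /eqP->; rewrite mem_head.
have -> : (last x s == a) = false by apply: contraNF xs => /eqP<-; rewrite mem_last.
by rewrite andbF.
Qed.

(** Exchanging a and b negates the imbalance; in terms of skew, it moves the whole
    imbalance over. *)
Lemma mult_swap cl s a b x y : a != b -> x != y ->
  mult cl (map (tperm a b) s) x y =
  mult cl s x y - skew a b (imbalance cl s a b) x y.
Proof.
move=> ab xy; have -> : mult cl (map (tperm a b) s) x y =
    mult cl s (tperm a b x) (tperm a b y).
  rewrite /mult item_sum_map; apply: eq_item_sum => u v.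
  by rewrite /joins !(can2_eq (tpermK a b) (tpermK a b)).
have ba : (b == a) = false by rewrite eq_sym (negPf ab).
have cmm (u z : V) := multC cl s u z.
move: xy; rewrite /skew /imbalance.
case: (tpermP a b x) => [->|->|/eqP/negPf xa /eqP/negPf xb];
  case: (tpermP a b y) => [->|->|/eqP/negPf ya /eqP/negPf yb];
  rewrite ?eqxx ?xa ?xb ?ya ?yb ?orbT ?(negPf ab) ?ba //= => _;
  rewrite ?(cmm x a) ?(cmm x b) ?(cmm b a); lia.
Qed.

Lemma sum_imbalance_le cl s a b :
  \sum_c `|imbalance cl s a b c| <=
  \sum_(c | (c != a) && (c != b)) (mult cl s a c + mult cl s b c).
Proof.
rewrite [leRHS]big_mkcond; apply: ler_sum => c _; rewrite /imbalance -negb_or.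
case: (_ || _) => /=; first by rewrite normr0.
by have := mult_ge0 cl s a c; have := mult_ge0 cl s b c; lia.
Qed.

Lemma sum_mult_off cl s a b : a != b -> uniq s ->
  \sum_(c | (c != a) && (c != b)) mult cl s a c + mult cl s a b <= 2.
Proof.
move=> ab /(degree_le2 cl a); apply: le_trans.
by rewrite [leRHS](bigD1 b) /= 1?eq_sym // addrC.
Qed.

Lemma sum_mult_off2 cl s a b : a != b -> uniq s ->
  \sum_(c | (c != a) && (c != b)) mult cl s b c + mult cl s a b <= 2.
Proof.
move=> ab us; under eq_bigl do rewrite andbC.
by rewrite (multC cl s a); apply: sum_mult_off; rewrite 1?eq_sym.
Qed.

(** The imbalance of the sequence is v plus a remainder, both of norm at most 2, and
    some rearrangement of the sequence flips v alone.  Flipping the remainder alone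
    is then possible too, by exchanging a and b after that rearrangement. *)
Definition splittable cl s a b :=
  exists v s', [/\ off a b v, \sum_c `|v c| <= 2,
    \sum_c `|imbalance cl s a b c - v c| <= 2,
    uniq s' /\ size s' = size s &
    forall x y, mult cl s' x y = mult cl s x y - skew a b v x y].

(** Here v collects the two pairs that join a and b to the segment P between them.
    The norm of the remainder needs no inspection of R and S: the degrees of a and b
    add up to at most 4, and P uses up one unit of each. *)
Lemma splittable_inner cl R a P b S : uniq (R ++ a :: P ++ b :: S) ->
  splittable cl (R ++ a :: P ++ b :: S) a b.
Proof.
set s := R ++ _ => us.
have ab : a != b.
  move: us; rewrite cat_uniq => /and3P[_ _] /=; rewrite mem_cat inE => /andP[].
  by rewrite !negb_or => /and3P[].
have off_sum : \sum_(c | (c != a) && (c != b)) (mult cl s a c + mult cl s b c)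
   + mult cl s a b *+ 2 <= 4.
  have := lerD (sum_mult_off cl ab us) (sum_mult_off2 cl ab us).
  by rewrite big_split mulr2n /= addrACA.
(* If a and b are adjacent, the pair ab itself uses up one unit of each degree,
   and v = 0 works. *)
case: P @s us off_sum => [|p P] s us off_sum.
  exists (fun=> 0), s; split=> //; first by rewrite big1.
    under eq_bigr do rewrite subr0.
    apply: le_trans (sum_imbalance_le cl s a b) _.
    have := @mult_adj _ cl R a b S ab; rewrite -/s; lia.
  by move=> x y; rewrite /skew !mulr0; lia.
set l := last p P.
have pl : forall c, c \in p :: P -> [&& c != a & c != b].
  move=> c cP; move: us; rewrite cat_uniq => /and3P[_ _].
  rewrite cons_uniq cat_uniq => /andP[aP /and4P[_ /hasPn bP _ _]].
  apply/andP; split; first by apply: contraNneq aP => <-; rewrite mem_cat cP.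
  by apply: contraTneq cP => ->; apply: bP; rewrite mem_head.
have /andP[pa pb] := pl p (mem_head _ _).
have /andP[la lb] := pl l (mem_last _ _).
pose v c : int := (c == p)%:R - (c == l)%:R.
exists v, (R ++ a :: rev (p :: P) ++ b :: S); split.
- by rewrite /off /v ![a == _]eq_sym ![b == _]eq_sym (negPf pa) (negPf pb) (negPf la) (negPf lb).
- apply: (@le_trans _ _ (\sum_c ((c == p)%:R + (c == l)%:R))).
    by apply: ler_sum => c _; rewrite /v; case: (c == p); case: (c == l).
  by rewrite big_split /= !sum_delta.
- have m1 : 1 <= mult cl s a p by apply: mult_adj; rewrite eq_sym.
  have m2 : 1 <= mult cl s b l.
    have -> : s = (R ++ a :: belast p P) ++ l :: b :: S.
      by rewrite -catA /= -[belast p P ++ _]cat_rcons -lastI.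
    by rewrite multC mult_adj.
  have : \sum_c `|imbalance cl s a b c - v c| <=
     \sum_(c | (c != a) && (c != b)) (mult cl s a c + mult cl s b c - ((c == p)%:R + (c == l)%:R)).
    rewrite [leRHS]big_mkcond; apply: ler_sum => c _; rewrite /imbalance -negb_or.
    case: eqVneq => [->|ca] /=.
      by rewrite /v ![a == _]eq_sym (negPf pa) (negPf la).
    case: eqVneq => [->|cb] /=.
      by rewrite /v ![b == _]eq_sym (negPf pb) (negPf lb).
    have := mult_ge0 cl s a c; have := mult_ge0 cl s b c; rewrite /v.
    move: m1 m2; case: (eqVneq c p) => [->|_]; case: (eqVneq _ l) => [->|_] /=; lia.
  move=> H; apply: le_trans H _; rewrite sumrB big_split [X in _ - X]big_split /=.
  rewrite !sum_delta ?pa ?pb ?la ?lb //.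
  have := mult_ge0 cl s a b; move: off_sum; rewrite big_split mulr2n /=.
  move: (\sum_(c | _) _) (\sum_(c | _) _) (mult cl s a b) => x y z; lia.
- split; last by rewrite !size_cat /= !size_cat size_rev.
  rewrite (perm_uniq (s2 := s)) // perm_cat2l perm_cons.
  by rewrite perm_cat2r perm_rev.
move=> x y; rewrite /mult item_sum_rev_inner; last by move=> u w; apply: joins_sym.
congr (_ - _); rewrite -/l /joins /skew /v.
rewrite ![p == _]eq_sym ![l == _]eq_sym ![a == _]eq_sym ![b == _]eq_sym.
rewrite -!mulnb !natrM; ring.
Qed.

Lemma skewC a b v x y : skew a b v x y = skew b a (fun c => - v c) x y.
Proof. rewrite /skew; ring. Qed.

Lemma splittableC cl s a b : splittable cl s b a -> splittable cl s a b.
Proof.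
have I c : imbalance cl s a b c = - imbalance cl s b a c.
  by rewrite /imbalance orbC; case: ifP => _; rewrite ?oppr0 // opprB.
move=> [v [s' [[va vb] v2 iv us E]]].
exists (fun c => - v c), s'; split => //.
- by rewrite /off va vb oppr0.
- by under eq_bigr do rewrite normrN.
- by under eq_bigr do rewrite I -opprD normrN.
- by move=> x y; rewrite E skewC.
Qed.

(** If only one of a and b occurs in s, then the whole imbalance comes from the at most
    two neighbours of that vertex. *)
Lemma splittableP cl s a b : a != b -> uniq s -> splittable cl s a b.
Proof.
move=> ab us.
have [/andP[aS bS]|notin] := boolP ((a \in s) && (b \in s)).
  case/splitPr: aS us bS => R S us; rewrite mem_cat inE eq_sym (negPf ab) /=.
  case/orP => [bR|bS]; last first.
    by case/splitPr: bS us => P S' us; apply: splittable_inner.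
  case/splitPr: bR us => R' P; rewrite -catA cat_cons => us.
  exact/splittableC/splittable_inner.
exists (fun=> 0), s; split=> //; first by rewrite big1.
  under eq_bigr do rewrite subr0.
  apply: le_trans (sum_imbalance_le cl s a b) _; rewrite big_split /=.
  move: notin; rewrite negb_and => /orP[/mult_notin N|/mult_notin N].
    rewrite big1 ?add0r => [|c _]; last exact: N.
    by apply: le_trans (sum_mult_off2 cl ab us); rewrite lerDl mult_ge0.
  rewrite [X in _ + X]big1 ?addr0 => [|c _]; last exact: N.
  by apply: le_trans (sum_mult_off cl ab us); rewrite lerDl mult_ge0.
by move=> x y; rewrite /skew !mulr0; lia.
Qed.

(** The four choices of signs are realised by s, by the rearrangement s' that flips
    the first vector, and by exchanging a and b in either of them. *)
Lemma switching cl s a b : a != b -> uniq s ->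
  exists v : bool -> V -> int,
  [/\ forall t, off a b (v t), forall t, \sum_c `|v t c| <= 2,
      forall c, v true c + v false c = imbalance cl s a b c &
      forall T : {set bool}, exists s', [/\ uniq s', size s' = size s &
       forall x y, x != y -> mult cl s' x y =
         mult cl s x y - skew a b (fun c => \sum_(t in T) v t c) x y]].
Proof.
move=> ab us; have [v [s' [[va vb] v2 iv [us' ss'] E]]] := splittableP cl ab us.
pose w c := imbalance cl s a b c - v c.
have [wa wb] : off a b w.
  by rewrite /off /w va vb; have [-> ->] := imbalance_off cl s a b.
have us'' r : uniq r -> uniq (map (tperm a b) r).
  by rewrite map_inj_uniq //; apply: perm_inj.
have I' c : imbalance cl s' a b c = w c - v c.
  rewrite /w /imbalance; case: eqVneq => [->|ca] /=; first by rewrite va; lia.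
  case: eqVneq => [->|cb] /=; first by rewrite vb; lia.
  rewrite !E /skew !eqxx (negPf ca) (negPf cb) [b == a]eq_sym (negPf ab) /=; lia.
exists (fun t => if t then v else w); split.
- by case.
- by case.
- by move=> c; rewrite /w; lia.
move=> T.
have sumT c : \sum_(t in T) (if t then v else w) c =
   (if true \in T then v c else 0) + (if false \in T then w c else 0).
  by rewrite big_mkcond big_bool.
case tT: (true \in T) sumT; case fT: (false \in T) => sumT.
- exists (map (tperm a b) s); split; rewrite ?size_map ?us'' // => x y xy.
  by rewrite mult_swap // /skew !sumT /w; congr (_ - _); ring.
- exists s'; split=> // x y xy.
  by rewrite E /skew !sumT; ring.
- exists (map (tperm a b) s'); split; rewrite ?size_map ?us'' // => x y xy.
  by rewrite mult_swap // E /skew !sumT !I'; ring.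
- exists s; split=> // x y xy.
  by rewrite /skew !sumT; ring.
Qed.
End Switching.

(** * Placements of least energy *)

Section Balanced.
Import Order.TTheory GRing.Theory Num.Theory.
Local Open Scope ring_scope.
Variables (V I : finType) (cl : I -> bool).
Implicit Types (a b c d x y z : V) (cfg : I -> seq V) (F : V -> V -> int).

Definition load cfg x y : int := \sum_i mult (cl i) (cfg i) x y.

(** Both orders of a pair are counted, which only doubles the sum of squares. *)
Definition energy cfg : int :=
  \sum_x \sum_(y | y != x) load cfg x y ^+ 2.

Lemma loadC cfg x y : load cfg x y = load cfg y x.
Proof. by apply: eq_bigr => i _; apply: multC. Qed.

Lemma sum_skew F a b (u : V -> int) : (forall x y, F x y = F y x) -> off a b u ->
  \sum_x \sum_(y | y != x) F x y * skew a b u x y =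
  (\sum_c u c * (F a c - F b c)) *+ 2.
Proof.
move=> FC [ua ub].
have delta (G : V -> int) z : \sum_x (x == z)%:R * G x = G z.
  by rewrite (bigD1 z) //= eqxx mul1r big1 ?addr0 // => x /negPf->; rewrite mul0r.
have rows z : \sum_x \sum_y F x y * ((x == z)%:R * u y) = \sum_y u y * F z y.
  rewrite exchange_big; apply: eq_bigr => y _.
  by rewrite -(delta (fun x => u y * F x y)); apply: eq_bigr => x _; ring.
have cols z : \sum_x \sum_y F x y * ((y == z)%:R * u x) = \sum_y u y * F z y.
  apply: eq_bigr => x _.
  by rewrite FC -(delta (fun y => u x * F x y)); apply: eq_bigr => y _; ring.
transitivity (\sum_x \sum_y F x y * skew a b u x y).
  apply: eq_bigr => x _; rewrite [RHS](bigD1 x) //=.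
  rewrite [skew a b u x x](_ : _ = 0) ?mulr0 ?add0r // /skew.
  by case: eqP => [->|_]; case: eqP => [->|_]; rewrite ?ua ?ub; ring.
rewrite /skew; under eq_bigr do under eq_bigr do rewrite !mulrBr mulrDr.
under eq_bigr do rewrite !sumrB big_split /=.
rewrite !sumrB big_split /= !rows !cols.
under [in RHS]eq_bigr do rewrite mulrBr.
by rewrite sumrB; ring.
Qed.

Definition placement (sz : I -> nat) cfg :=
  forall i, uniq (cfg i) /\ size (cfg i) = sz i.

(** Flipping a set of vectors with sum u replaces the load w by w - skew u.  Because
    u is supported off a and b, the energy changes by 4 (|u|^2 - <u, d>), where
    d c = w(ac) - w(bc) is the sum of all the vectors; balancing supplies a
    set for which this is negative. *)
Lemma energy_decrease sz cfg a b c : placement sz cfg ->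
  a != b -> a != c -> b != c -> 2 < `|load cfg a c - load cfg b c| ->
  exists2 cfg', placement sz cfg' & energy cfg' < energy cfg.
Proof.
move=> pl ab ac bc big.
have /fin_all_exists[v vP] i := switching (cl i) ab (pl i).1.
pose vv (j : I * bool) := v j.1 j.2.
have sumv d : \sum_j vv j d = \sum_i imbalance (cl i) (cfg i) a b d.
  rewrite -(pair_bigA _ (fun i t => v i t d)) /=; apply: eq_bigr => i _.
  by rewrite big_bool /=; have [_ _ ->] := vP i.
have sumvE d : d != a -> d != b -> \sum_j vv j d = load cfg a d - load cfg b d.
  move=> /negPf da /negPf db; rewrite sumv -sumrB; apply: eq_bigr => i _.
  by rewrite /imbalance da db.
have [|X Xlt] := @balancing _ _ vv c (fun j => let: And4 _ h _ _ := vP j.1 in h j.2).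
  by rewrite sumvE // eq_sym.
pose T i := [set t | (i, t) \in X].
have /fin_all_exists[cfg' cfgP] i : exists s',
    [/\ uniq s', size s' = size (cfg i) &
     forall x y, x != y -> mult (cl i) s' x y = mult (cl i) (cfg i) x y
       - skew a b (fun d => \sum_(t in T i) v i t d) x y].
  by have [_ _ _ /(_ (T i))] := vP i.
pose u d := \sum_(j in X) vv j d.
have uE d : \sum_i \sum_(t in T i) v i t d = u d.
  rewrite pair_big_dep /=; apply: eq_big => [[i t]|[i t] _] //=.
  by rewrite inE.
have uoff : off a b u.
  by split; apply: big1 => j _; have [/(_ j.2)[? ?] _ _ _] := vP j.1.
have loadE x y : x != y -> load cfg' x y = load cfg x y - skew a b u x y.
  move=> xy; have cfgE i : mult (cl i) (cfg' i) x y = mult (cl i) (cfg i) x y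
       - skew a b (fun d => \sum_(t in T i) v i t d) x y.
    by have [_ _] := cfgP i; apply.
  rewrite /load; under eq_bigr do rewrite cfgE.
  rewrite sumrB; congr (_ - _); rewrite /skew !sumrB big_split /= -!mulr_sumr.
  by rewrite !uE.
exists cfg'.
  by move=> i; have [-> -> _] := cfgP i; split => //; apply: (pl i).2.
have skC x y : skew a b u x y = skew a b u y x by rewrite /skew; ring.
have [ua ub] := uoff.
have -> : energy cfg' = energy cfg
   - (\sum_x \sum_(y | y != x) load cfg x y * skew a b u x y) *+ 2
   + \sum_x \sum_(y | y != x) skew a b u x y * skew a b u x y.
  rewrite /energy -sumrMnl -sumrB -big_split /=; apply: eq_bigr => x _.
  rewrite -sumrMnl -sumrB -big_split /=; apply: eq_bigr => y yx.
  by rewrite loadE 1?eq_sym //; ring.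
rewrite !sum_skew //; last exact: loadC.
have -> : \sum_d u d * (load cfg a d - load cfg b d) = \sum_d u d * \sum_j vv j d.
  apply: eq_bigr => d _; case: (eqVneq d a) => [->|da]; first by rewrite ua !mul0r.
  by case: (eqVneq d b) => [->|db]; rewrite ?ub ?mul0r // sumvE.
have -> : \sum_d u d * (skew a b u a d - skew a b u b d) = (\sum_d u d ^+ 2) *+ 2.
  rewrite -sumrMnl; apply: eq_bigr => d _.
  case: (eqVneq d a) => [->|da]; first by rewrite ua mul0r expr0n mul0rn.
  case: (eqVneq d b) => [->|db]; first by rewrite ub mul0r expr0n mul0rn.
  rewrite /skew !eqxx (negPf da) (negPf db) [b == a]eq_sym (negPf ab) ua ub /=.
  by ring.
have {}Xlt : \sum_d u d ^+ 2 < \sum_d u d * \sum_j vv j d by [].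
rewrite !mulr2n; move: Xlt (energy cfg).
by move: (\sum_d u d ^+ 2) (\sum_d u d * _) => p q pq e; lia.
Qed.

(** At a placement of least energy, w(ac) and w(bc) differ by at most 2; two pairs
    xy and zt are compared through zy. *)
Lemma balanced_placement sz cfg0 : placement sz cfg0 ->
  exists2 cfg, placement sz cfg &
    forall x y z t, x != y -> z != t -> load cfg x y <= load cfg z t + 4.
Proof.
have energy_ge0 cfg : 0 <= energy cfg.
  by apply: sumr_ge0 => x _; apply: sumr_ge0 => y _; apply: sqr_ge0.
have [m] := ubnP `|energy cfg0|%N; elim: m => // m IH in cfg0 * => lem pl.
have [bal|] :=
  boolP [forall a, forall b, forall c,
     [&& a != b, a != c & b != c] ==> (`|load cfg0 a c - load cfg0 b c| <= 2)].
  exists cfg0 => // x y z t xy zt.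
  have near p q r : p != r -> q != r -> load cfg0 p r <= load cfg0 q r + 2.
    move=> pr qr; have [->|pq] := eqVneq p q; first by rewrite lerDl.
    have /forallP/(_ p)/forallP/(_ q)/forallP/(_ r) := bal.
    by rewrite pq pr qr /=; lia.
  rewrite eq_sym in zt; rewrite (loadC cfg0 z).
  have [yz|yz] := eqVneq y z.
    by move: (near x t z); rewrite yz in xy *; move=> /(_ xy zt); lia.
  move: (near x z y xy) (near y t z yz zt); rewrite eq_sym => /(_ yz).
  by rewrite (loadC cfg0 z y); lia.
rewrite negb_forall => /existsP[a]; rewrite negb_forall => /existsP[b].
rewrite negb_forall => /existsP[c]; rewrite negb_imply -ltNge.
case/andP => /and3P[ab ac bc] big.
have [cfg1 pl1 lt1] := energy_decrease pl ab ac bc big.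
apply: (IH cfg1) => //; have := energy_ge0 cfg1; lia.
Qed.
End Balanced.

(** * Hall's theorem *)

Section Hall.
Variables (A B : finType).
Implicit Types (N : {ffun A -> {set B}}) (S : {set A}).

Definition nbhd N S : {set B} := \bigcup_(a in S) N a.

Definition hall_condition N := [forall S : {set A}, #|S| <= #|nbhd N S|].

Definition drop_nb N a b : {ffun A -> {set B}} :=
  [ffun x => if x == a then N a :\ b else N x].

Lemma nbhd_drop N a b S : nbhd (drop_nb N a b) S =
  nbhd N (S :\ a) :|: (if a \in S then N a :\ b else set0).
Proof.
rewrite /nbhd; case: ifP => aS.
  rewrite (big_setD1 a aS) /= ffunE eqxx setUC; congr (_ :|: _).
  by apply: eq_bigr => x; rewrite !inE ffunE => /andP[/negPf->].
rewrite setU0; have -> : S :\ a = S by apply/setDidPl; rewrite disjoint_sym disjoints1 aS.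
apply: eq_bigr => x xS; rewrite ffunE; case: eqP => // xa.
by rewrite -xa xS in aS.
Qed.

(** A set that violates Hall's condition after b is removed from N a contains a, and
    it fails by exactly one; the rest of it is the set S. *)
Lemma drop_violation N a b : hall_condition N -> ~~ hall_condition (drop_nb N a b) ->
  exists2 S : {set A}, a \notin S & #|nbhd N S :|: (N a :\ b)| <= #|S|.
Proof.
move=> /forallP H; rewrite negb_forall => /existsP[S]; rewrite -ltnNge nbhd_drop.
case: ifP => aS; last first.
  have /setDidPl -> : [disjoint S & [set a]] by rewrite disjoint_sym disjoints1 aS.
  by rewrite setU0 ltnNge H.
rewrite (cardsD1 a S) aS add1n ltnS => le; exists (S :\ a) => //.
by rewrite !inE eqxx.
Qed.

(** If both b1 and b2 were needed in N a, the two violating sets S1 and S2 would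
    contradict submodularity: the neighbourhoods of a, S1, S2 together have more
    than |S1 :|: S2| elements, those of S1 :&: S2 at least |S1 :&: S2|. *)
Lemma minimal_hall N a b1 b2 : hall_condition N ->
  (forall b, b \in N a -> ~~ hall_condition (drop_nb N a b)) ->
  b1 \in N a -> b2 \in N a -> b1 = b2.
Proof.
move=> H min b1N b2N.
have HS (S : {set A}) : #|S| <= #|nbhd N S| by apply: (forallP H).
apply/eqP; apply: contraT => b12.
have [S1 aS1 le1] := drop_violation H (min _ b1N).
have [S2 aS2 le2] := drop_violation H (min _ b2N).
move: le1 le2; set X1 := _ :|: _; set X2 := _ :|: _ => le1 le2.
have leU : #|S1 :|: S2| + 1 <= #|X1 :|: X2|.
  have -> : X1 :|: X2 = nbhd N (a |: (S1 :|: S2)).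
    rewrite /nbhd bigcup_setU big_set1 bigcup_setU /X1 /X2.
    apply/setP => b; rewrite !inE; case: (b \in N a); last by rewrite !andbF !orbF.
    rewrite /= !andbT; case: (eqVneq b b1) => [->|_]; last by rewrite orbT.
    by rewrite b12 /= !orbT.
  have := HS (a |: (S1 :|: S2)); apply: leq_trans.
  by rewrite cardsU1 !inE negb_or aS1 aS2 addnC.
have leI : #|S1 :&: S2| <= #|X1 :&: X2|.
  apply: leq_trans (HS _) _; apply/subset_leq_card/subsetP => b.
  case/bigcupP => s /setIP[s1 s2] bs; rewrite !inE.
  by rewrite !(introT bigcupP) //; exists s.
by have := cardsUI S1 S2; have := cardsUI X1 X2; lia.
Qed.

(** In a family that is minimal among those satisfying Hall's condition, every
    neighbourhood is a single point, and the condition for two-element sets makes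
    these points distinct. *)
Theorem hall (N : A -> {set B}) :
  (forall S : {set A}, #|S| <= #|\bigcup_(a in S) N a|) ->
  exists f : A -> B, injective f /\ forall a, f a \in N a.
Proof.
move=> H.
pose P (M : {ffun A -> {set B}}) := hall_condition M && [forall a, M a \subset N a].
have P0 : P (finfun N).
  apply/andP; split; last by apply/forallP => a; rewrite ffunE.
  apply/forallP => S; apply: leq_trans (H S) _.
  by rewrite /nbhd [X in _ <= #|pred_of_set X|](eq_bigr N) // => a _; rewrite ffunE.
case: (arg_minnP (fun M : {ffun A -> {set B}} => \sum_a #|M a|) P0) => M.
case/andP => hM /forallP MN min.
have drop a b : b \in M a -> ~~ hall_condition (drop_nb M a b).
  move=> bM; apply/negP => hD.
  have : P (drop_nb M a b).
    rewrite /P hD; apply/forallP => x; rewrite ffunE; case: eqP => [->|_ //].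
    by apply: subset_trans (MN a); rewrite subD1set.
  move/min; rewrite (bigD1 a) //= [X in _ <= X](bigD1 a) //= ffunE eqxx (cardsD1 b (M a)) bM.
  have -> : \sum_(x | x != a) #|drop_nb M a b x| = \sum_(x | x != a) #|M x|.
    by apply: eq_bigr => x /negPf xa; rewrite ffunE xa.
  by rewrite leq_add2r add1n ltnn.
have ex a : exists b, b \in M a.
  apply/set0Pn; rewrite -card_gt0.
  by have /forallP/(_ [set a]) := hM; rewrite cards1 /nbhd big_set1.
have /fin_all_exists[f fM] := ex.
exists f; split=> [a a' e|a]; last exact/(subsetP (MN a)).
apply/eqP; apply: contraT => aa'.
have one x : M x = [set f x].
  apply/setP => b; rewrite inE; apply/idP/eqP => [bM|->//].
  by apply: (minimal_hall hM (@drop x)).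
have /forallP/(_ [set a; a']) := hM.
by rewrite cards2 aa' /nbhd bigcup_setU !big_set1 !one e setUid cards1.
Qed.
End Hall.

(** * Counting cliques *)

Lemma card_sep (T : finType) (X : {set T}) (P : pred T) :
  #|[set x in X | P x]| = \sum_(x in X) P x.
Proof.
by rewrite -sum1dep_card big_mkcondr; apply: eq_bigr => x _; case: (P x).
Qed.

Section Cliques.
Variable V : finType.
Implicit Types (A B C f : {set V}) (G F : {set {set V}}) (i j r : nat).

Definition ksets j : {set {set V}} := [set A : {set V} | #|A| == j].

Definition is_clique G A := [forall f in ksets 2, (f \subset A) ==> (f \in G)].

Definition cliques j G := [set A in ksets j | is_clique G A].

Definition hits j F := [set A in ksets j | [exists f in F, f \subset A]].

Lemma cliqueP G A : reflect (forall f, #|f| = 2 -> f \subset A -> f \in G) (is_clique G A).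
Proof.
apply: (iffP forall_inP) => H f.
  by move=> f2 fA; apply: implyP (H f _) fA; rewrite inE f2.
by rewrite inE => /eqP f2; apply/implyP/H.
Qed.

Lemma card_ksets j : #|ksets j| = 'C(#|V|, j).
Proof. by rewrite -card_draws. Qed.

Lemma card_subsets i A : #|[set B in ksets i | B \subset A]| = 'C(#|A|, i).
Proof. by rewrite -cards_draws; apply: eq_card => B; rewrite !inE andbC. Qed.

Lemma card_supersets i j B : B \in ksets i -> i <= j ->
  #|[set A in ksets j | B \subset A]| = 'C(#|V| - i, j - i).
Proof.
rewrite inE => /eqP Bi ij.
have unionK C : C \subset ~: B -> (B :|: C) :\: B = C.
  by move=> CB; rewrite setDUl setDv set0U; apply/setDidPl; rewrite disjoints_subset.
have -> : [set A in ksets j | B \subset A] =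
    [set B :|: C | C in [set C in ksets (j - i) | C \subset ~: B]].
  apply/setP => A; rewrite !inE; apply/andP/imsetP => [[/eqP Aj BA]|[C]].
    exists (A :\: B); last by rewrite -{1}(setID A B) (setIidPr BA).
    by rewrite !inE cardsD (setIidPr BA) Aj Bi eqxx /= setDE subsetIr.
  rewrite !inE => /andP[/eqP Cji CB] ->; rewrite subsetUl; split=> //.
  have BC : [disjoint B & C] by rewrite disjoint_sym disjoints_subset.
  by rewrite cardsU (eqP (_ : B :&: C == set0)) ?setI_eq0 // cards0 subn0 Bi Cji subnKC.
rewrite card_in_imset ?card_subsets; first by rewrite [#|~: B|]cardsCs setCK Bi.
by move=> C C'; rewrite !inE => /andP[_ /unionK{2}<-] /andP[_ /unionK{2}<-] ->.
Qed.

Lemma clique_sub G A B : B \subset A -> is_clique G A -> is_clique G B.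
Proof.
move=> BA /cliqueP cA; apply/cliqueP => f f2 fB.
by apply: cA => //; apply: subset_trans BA.
Qed.

Lemma exchange_incidence (S T : {set {set V}}) :
  \sum_(A in S) #|[set B in T | B \subset A]| =
  \sum_(B in T) #|[set A in S | B \subset A]|.
Proof.
under eq_bigr do rewrite card_sep.
by rewrite exchange_big /=; apply: eq_bigr => B _; rewrite card_sep.
Qed.

(** Every i-subset of a clique is a clique; this bounds the density of j-cliques by
    the density of i-cliques. *)
Lemma cliques_average i j G : i <= j ->
  #|cliques j G| * 'C(j, i) <= #|cliques i G| * 'C(#|V| - i, j - i).
Proof.
move=> ij; have -> : #|cliques j G| * 'C(j, i) =
    \sum_(A in cliques j G) #|[set B in cliques i G | B \subset A]|.
  rewrite -sum_nat_const; apply: eq_bigr => A; rewrite !inE => /andP[/eqP {1}<- cA].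
  rewrite -card_subsets; apply: eq_card => B; rewrite !inE.
  by case BA: (B \subset A); rewrite ?andbF // (clique_sub BA cA) !andbT.
rewrite exchange_incidence -sum_nat_const; apply: leq_sum => B; rewrite inE => /andP[Bi _].
rewrite -(card_supersets Bi ij); apply/subset_leq_card/subsetP => A.
by rewrite !inE => /andP[/andP[-> _] ->].
Qed.

(** A 4-clique contains six pairs of G, each leaving a pair of G as its complement;
    a 4-clique is determined by a pair and its complement. *)
Lemma four_cliques G : 6 * #|cliques 4 G| <= #|G| ^ 2.
Proof.
have -> : 6 * #|cliques 4 G| =
    \sum_(A in cliques 4 G) #|[set B in [set f in ksets 2 | f \in G] | B \subset A]|.
  rewrite mulnC -sum_nat_const; apply: eq_bigr => A; rewrite !inE => /andP[/eqP A4 /cliqueP cA].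
  have -> : 6 = 'C(#|A|, 2) by rewrite A4.
  rewrite -card_subsets; apply: eq_card => B; rewrite !inE.
  by case BA: (B \subset A); rewrite ?andbF //; case: eqP => // B2; rewrite cA.
rewrite exchange_incidence.
apply: (@leq_trans (\sum_(f in [set f in ksets 2 | f \in G]) #|G|)).
  apply: leq_sum => f; rewrite !inE => /andP[/eqP f2 fG].
  rewrite -(@card_in_imset _ _ (fun A => A :\: f)).
    apply/subset_leq_card/subsetP => _ /imsetP[A + ->].
    rewrite !inE => /andP[/andP[/eqP A4 /cliqueP cA] fA]; apply: cA.
      by rewrite cardsD (setIidPr fA) A4 f2.
    exact: subsetDl.
  move=> A A'; rewrite !inE => /andP[_ fA] /andP[_ fA'] E.
  by rewrite -(setID A f) -(setID A' f) (setIidPr fA) (setIidPr fA') E.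
rewrite sum_nat_const -mulnn leq_mul2r subset_leq_card ?orbT //.
by apply/subsetP => f; rewrite !inE => /andP[].
Qed.

(** The number t v of triangles at v is at most |G|, and at most d^2 / 2 for a vertex
    of degree d.  Whichever bound is smaller is at most d * r: use the second one
    for d <= 2 r and the first one for d > 2 r.  Then sum over v. *)
Lemma three_cliques G r : #|G| <= 2 * r ^ 2 -> G \subset ksets 2 ->
  3 * #|cliques 3 G| <= 2 * #|G| * r.
Proof.
move=> Gr G2.
pose t v := #|[set A in cliques 3 G | v \in A]|.
pose d v := #|[set f in G | v \in f]|.
have incid (S : {set {set V}}) : \sum_v #|[set A in S | v \in A]| = \sum_(A in S) #|A|.
  have -> : \sum_v #|[set A in S | v \in A]| = \sum_v \sum_(A in S) (v \in A : nat).
    by apply: eq_bigr => v _; rewrite card_sep.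
  by rewrite exchange_big; apply: eq_bigr => A _; rewrite -sum1_card [RHS]big_mkcond.
have -> : 3 * #|cliques 3 G| = \sum_v t v.
  rewrite incid mulnC -sum_nat_const; apply: eq_bigr => A.
  by rewrite !inE => /andP[/eqP-> _].
have -> : 2 * #|G| * r = (\sum_v d v) * r.
  rewrite incid (mulnC 2) -sum_nat_const; congr (_ * r); apply: eq_bigr => f fG.
  by move/subsetP: G2 => /(_ f fG); rewrite inE => /eqP.
rewrite big_distrl; apply: leq_sum => v _ /=.
have del_inj : {in [set A in cliques 3 G | v \in A] &, injective (fun A => A :\ v)}.
  move=> A A'; rewrite !inE => /andP[_ vA] /andP[_ vA'] E.
  by rewrite -(setD1K vA) -(setD1K vA') E.
have tG : t v <= #|G|.
  rewrite /t -(card_in_imset del_inj); apply/subset_leq_card/subsetP => _ /imsetP[A + ->].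
  rewrite !inE => /andP[/andP[/eqP A3 /cliqueP cA] vA]; apply: cA; last exact: subD1set.
  by move: A3; rewrite (cardsD1 v) vA => -[].
pose N := [set u | (u != v) && ([set v; u] \in G)].
have Nd : #|N| <= d v.
  rewrite -(@card_in_imset _ _ (fun u => [set v; u])).
    apply/subset_leq_card/subsetP => _ /imsetP[u + ->].
    by rewrite !inE eqxx => /andP[_ ->].
  move=> u u'; rewrite !inE => /andP[uv _] /andP[uv' _] /setP/(_ u).
  by rewrite !inE eqxx orbT (negPf uv) /= => /esym/eqP.
have tN : t v <= 'C(#|N|, 2).
  rewrite /t -(card_in_imset del_inj) -card_subsets; apply/subset_leq_card/subsetP => _ /imsetP[A + ->].
  rewrite !inE => /andP[/andP[/eqP A3 /cliqueP cA] vA].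
  have -> /= : #|A :\ v| == 2 by apply/eqP; move: A3; rewrite (cardsD1 v) vA => -[].
  apply/subsetP => u; rewrite !inE => /andP[uv uA]; rewrite uv.
  by apply: cA; [rewrite cards2 eq_sym uv | rewrite subUset !sub1set vA].
have tN2 : 2 * t v <= #|N| * #|N|.
  move: tN; rewrite bin2; case: (#|N|) => // m /=; lia.
apply: leq_trans (leq_mul Nd (leqnn r)).
have [Nr|rN] := leqP #|N| (2 * r); first by nia.
by apply: leq_trans (leq_trans tG Gr) _; nia.
Qed.

(** Count the pairs of F inside all j-sets: a j-set that contains a pair of F contains at
    most C(j, 2) - 1 of them, unless it is a clique. *)
Lemma hits_lower j F : F \subset ksets 2 -> 2 <= j ->
  #|F| * 'C(#|V| - 2, j - 2) <= ('C(j, 2)).-1 * #|hits j F| + #|cliques j F|.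
Proof.
move=> F2 j2.
have -> : #|F| * 'C(#|V| - 2, j - 2) = \sum_(f in F) #|[set A in ksets j | f \subset A]|.
  rewrite -sum_nat_const; apply: eq_bigr => f fF.
  by rewrite (card_supersets (subsetP F2 f fF)).
rewrite -exchange_incidence.
have -> : #|cliques j F| = \sum_(A in ksets j) is_clique F A.
  by rewrite card_sep.
have -> : #|hits j F| = \sum_(A in ksets j) [exists f in F, f \subset A].
  by rewrite card_sep.
rewrite big_distrr -big_split /=; apply: leq_sum => A; rewrite inE => /eqP Aj.
have sub : [set B in F | B \subset A] \subset [set B in ksets 2 | B \subset A].
  by apply/subsetP => B; rewrite !inE => /andP[/(subsetP F2) + ->]; rewrite inE => ->.
case: existsP => [_|no] /=; last first.
  rewrite muln0 add0n; apply: leq_trans (leq0n _); rewrite leqn0 cards_eq0.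
  apply/eqP/setP => B; rewrite !inE; apply/negP => /andP[BF BA]; apply: no.
  by exists B; rewrite BF.
rewrite muln1 -{1}Aj -card_subsets.
case: cliqueP => [cA|ncA] /=.
  by rewrite addn1; apply: leq_trans (subset_leq_card sub) (leqSpred _).
suff : #|[set B in F | B \subset A]| < #|[set B in ksets 2 | B \subset A]|.
  by move=> lt; rewrite addn0 -ltnS (ltn_predK lt).
apply/proper_card; rewrite properE sub; apply/negP => sup; apply: ncA => f f2 fA.
by move: (subsetP sup f); rewrite !inE f2 eqxx fA !andbT => ->.
Qed.

Lemma hits_cliques j F : F \subset ksets 2 ->
  #|hits j F| + #|cliques j (ksets 2 :\: F)| = 'C(#|V|, j).
Proof.
move=> F2; rewrite -card_ksets -(cardsID (hits j F) (ksets j)); congr (_ + _).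
  by apply: eq_card => A; rewrite !inE andbA andbb.
apply: eq_card => A; rewrite !inE; case: eqP => //= Aj; rewrite andbT.
apply/cliqueP/negP => [cA /exists_inP[f fF fA]|no f f2 fA].
  have f2 : #|f| = 2 by have := subsetP F2 f fF; rewrite inE => /eqP.
  by have := cA f f2 fA; rewrite !inE fF.
rewrite !inE f2 eqxx andbT; apply/negP => fF; apply: no.
by apply/exists_inP; exists f.
Qed.
End Cliques.

(** * Hall's condition for nearly uniform loads *)

Lemma leq_bin_half n i j : i <= j -> 2 * j <= n.+1 -> 'C(n, i) <= 'C(n, j).
Proof.
move=> ij; elim: j ij => [|j IH]; first by rewrite leqn0 => /eqP->.
rewrite leq_eqVlt => /predU1P[->//|]; rewrite ltnS => ij jn.
apply: leq_trans (IH ij _) _; first by lia.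
rewrite -(leq_pmul2l (ltn0Sn j)) mul_bin_left leq_mul2r; lia.
Qed.

Lemma leq_bin_middle n i k : i <= k -> i + k <= n -> 'C(n, i) <= 'C(n, k).
Proof.
move=> ik ikn; have [le|lt] := leqP (2 * k) n.
  by apply: leq_bin_half => //; lia.
by rewrite -(@bin_sub n k); [apply: leq_bin_half; lia | lia].
Qed.

Lemma bin2_double n : 'C(n, 2) * 2 = n * (n - 1).
Proof. by rewrite mulnC mul_bin_left bin1 mulnC. Qed.

(** The next three lemmas are the arithmetic for k = 3, where r = (n - 16) / 2 is
    used in the triangle bound for M and r = (n - 26) / 2 in the one for F.  With
    the first, 2 r mu <= 3 q follows from 3 (q + 4) >= mu (n - 2); the second leaves 3 |hits| >= (n + 10) |F|, which absorbs the error 4. *)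
Lemma sparse_triangles_arith mu n q e U : 0 < mu -> 108 <= n ->
  mu * (n - 2) <= 3 * (q + 4) -> 3 * U <= 2 * e * (n - 16)./2 ->
  mu * U <= q * e.
Proof.
move=> mu0 n108 hq hU.
have r2 : 2 * (n - 16)./2 <= n - 16 by lia.
have h1 : mu * (n - 2) = mu * (n - 16) + mu * 14 by rewrite -mulnDr; congr (_ * _); lia.
have h2 : mu * (n - 16) <= 3 * q by lia.
have h3 : 3 * U <= (n - 16) * e.
  by apply: leq_trans hU _; rewrite mulnAC leq_mul2r r2 orbT.
have : mu * (3 * U) <= 3 * q * e.
  apply: leq_trans (leq_mul (leqnn mu) h3) _.
  by rewrite mulnA leq_mul2r h2 orbT.
by rewrite mulnCA -mulnA leq_pmul2l.
Qed.

Lemma dense_triangles_arith n e f : 108 <= n -> (f + e) * 2 = n * (n - 1) ->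
  2 * (n - 16)./2 ^ 2 < e -> f <= 2 * (n - 26)./2 ^ 2.
Proof.
move=> n108 fe.
have r1 : n - 17 <= 2 * (n - 16)./2 by lia.
have r2 : n - 27 <= 2 * (n - 26)./2 by lia.
move: ((n - 16)./2) ((n - 26)./2) r1 r2 => r r' r1 r2 er.
have h1 := leq_mul r1 r1; have h2 := leq_mul r2 r2.
have : n * n + 729 = (n - 27) * (n - 27) + 54 * n by nia.
have : n * n + 289 = (n - 17) * (n - 17) + 34 * n by nia.
have : 108 * n <= n * n by rewrite leq_mul2r n108 orbT.
rewrite -!mulnn in er *; nia.
Qed.

Lemma triangle_hits_arith mu n q w f H T : 0 < mu -> 108 <= n ->
  3 * q <= mu * (n - 2) -> w <= (q + 4) * f ->
  f * (n - 2) <= 2 * H + T -> 3 * T <= 2 * f * (n - 26)./2 ->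
  w <= mu * H.
Proof.
move=> mu0 n108 hq hw hH hT.
have r2 : 2 * (n - 26)./2 <= n - 26 by lia.
have h3 : 3 * T <= f * (n - 26).
  by apply: leq_trans hT _; rewrite mulnAC mulnC leq_mul2l r2 orbT.
have e1 : f * (n - 2) = f * (n - 26) + f * 24 by rewrite -mulnDr; congr (_ * _); lia.
have e2 : f * (n + 10) = f * (n - 26) + f * 36 by rewrite -mulnDr; congr (_ * _); lia.
have h4 : f * (n + 10) <= 3 * H by lia.
have e3 : mu * (n + 10) = mu * (n - 2) + mu * 12 by rewrite -mulnDr; congr (_ * _); lia.
have h5 : 3 * (q + 4) <= mu * (n + 10) by lia.
have : 3 * w <= mu * (3 * H).
  apply: leq_trans (leq_mul (leqnn mu) h4).
  apply: leq_trans (leq_mul (leqnn 3) hw) _.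
  by rewrite mulnA mulnCA mulnC leq_mul2l h5 orbT.
by rewrite mulnCA leq_pmul2l.
Qed.

(** The arithmetic for 4 <= k <= n - 4.  Here C, E and c stand for C(n, 4), C(n, 2)
    and C(n - 2, 2), and N is the number of edges; N >= C makes the
    error 4 E, by which q E may fall short of N, at most 24 N / c. *)
Lemma sparse_four_cliques_arith N C c E q e u : 0 < C ->
  C * 6 = E * c -> C <= N -> N <= (q + 4) * E ->
  6 * u <= e ^ 2 -> e + 24 <= c -> u * N <= q * e * C.
Proof.
move=> C0 C6 CN NE ue ec.
have h1 : c * N <= 6 * q * C + 24 * C.
  have -> : 6 * q * C + 24 * C = (q + 4) * (C * 6) by nia.
  by rewrite C6 mulnA mulnC leq_mul2r NE orbT.
have h2 : e * N + 24 * N <= c * N by rewrite -mulnDl leq_mul2r ec orbT.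
have h3 : e * N <= 6 * q * C by lia.
have h4 : 6 * u * N <= e * (e * N) by rewrite mulnA leq_mul2r mulnn ue orbT.
have h5 : e * (e * N) <= e * (6 * q * C) by rewrite leq_mul2l h3 orbT.
rewrite -(leq_pmul2l (isT : 0 < 6)) mulnA; apply: leq_trans h4 (leq_trans h5 _).
by apply/eq_leq; nia.
Qed.

Lemma four_hits_arith N C c E q w f H K : 0 < C ->
  C * 6 = E * c -> C <= N -> q * E <= N -> w <= (q + 4) * f ->
  f * c <= 5 * H + K -> 6 * K <= f ^ 2 -> f + 120 <= c ->
  w * C <= N * H.
Proof.
move=> C0 C6 CN qE hw hH hK fc.
have h1 : f * (6 * c - f) <= 30 * H.
  have fc6 : f <= 6 * c by clear -fc; lia.
  have : f * (6 * c - f) + f * f = 6 * (f * c) by rewrite -mulnDr subnK // mulnCA.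
  rewrite -mulnn in hK; clear -hH hK; move: hH hK.
  by move: (f * (6 * c - f)) (f * f) (f * c) => x y z; lia.
have h2 : 30 * (q + 4) * C <= N * (6 * c - f).
  have e1 : 30 * (q + 4) * C = 5 * (q * E * c) + 120 * C by rewrite -(mulnA q) -C6; nia.
  have h3 : q * E * c <= N * c by rewrite leq_mul2r qE orbT.
  have h4 : N * (5 * c + 120) <= N * (6 * c - f) by rewrite leq_mul2l; apply/orP; right; lia.
  by rewrite e1; apply: leq_trans h4; rewrite mulnDr; lia.
rewrite -(leq_pmul2l (isT : 0 < 30)).
apply: (@leq_trans (f * (30 * (q + 4) * C))).
  have : w * (30 * C) <= (q + 4) * f * (30 * C) by rewrite leq_mul2r hw orbT.
  by move=> h; rewrite mulnCA; apply: leq_trans h _; apply/eq_leq; nia.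
apply: (@leq_trans (f * (N * (6 * c - f)))); first by rewrite leq_mul2l h2 orbT.
by rewrite mulnCA [30 * _]mulnCA leq_mul2l h1 orbT.
Qed.

(** The arithmetic for k = n - 2 and k = n - 3, with n = m + 38. *)
Lemma codim2_arith mu m q w f H : 0 < mu -> q <= mu ->
  w <= (q + 4) * f -> 2 * f + (m + 36) * (m + 35) <= (m + 38) * (m + 37) ->
  (m + 36) * (m + 35) <= 2 * H -> w <= mu * H.
Proof.
move=> mu0 qmu hw hf hH.
have hf' : f <= 2 * m + 73 by clear -hf; lia.
have h1 : w <= (5 * mu) * (2 * m + 73).
  by apply: leq_trans hw (leq_mul _ hf'); clear -mu0 qmu; lia.
have h2 : 5 * (2 * m + 73) <= H by clear -hH; lia.
by apply: leq_trans h1 _; rewrite mulnAC mulnC leq_mul2l h2 orbT.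
Qed.

Lemma codim3_arith mu m q w f H : 0 < mu -> 3 * q <= mu * (m + 36) ->
  w <= (q + 4) * f -> 2 * f + (m + 35) * (m + 34) <= (m + 38) * (m + 37) ->
  (m + 36) * ((m + 35) * (m + 34)) <= 6 * H -> w <= mu * H.
Proof.
move=> mu0 hq hw hf hH.
have hf' : f <= 3 * (m + 36) by clear -hf; lia.
have h1 : 3 * (q + 4) <= mu * (m + 48).
  have -> : m + 48 = m + 36 + 12 by lia.
  by rewrite mulnDr; clear -mu0 hq; lia.
have h2 : (m + 48) * (3 * (m + 36)) <= 3 * H.
  have h3 : 6 * (m + 48) <= (m + 35) * (m + 34) by clear; lia.
  have := leq_mul (leqnn (m + 36)) h3; move/leq_trans => /(_ _ hH) h4.
  by clear -h4; lia.
rewrite -(leq_pmul2l (isT : 0 < 3)) mulnCA; apply: leq_trans (leq_mul (leqnn mu) h2).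
apply: leq_trans (leq_mul (leqnn 3) (leq_trans hw (leq_mul (leqnn _) hf'))) _.
by rewrite mulnA [leqRHS]mulnA leq_mul2r h1 orbT.
Qed.

Section Counting.
Variable V : finType.
Implicit Types (F G : {set {set V}}).
Local Notation n := #|V|.

(** Obtained by counting pairs B of size i inside A of size j in both orders. *)
Lemma bin_bin i j : i <= j -> 'C(n, j) * 'C(j, i) = 'C(n, i) * 'C(n - i, j - i).
Proof.
move=> ij; rewrite -!card_ksets -!sum_nat_const.
transitivity (\sum_(A in ksets V j) #|[set B in ksets V i | B \subset A]|).
  by apply: eq_bigr => A; rewrite inE => /eqP Aj; rewrite card_subsets Aj.
by rewrite exchange_incidence; apply: eq_bigr => B Bi; rewrite (card_supersets Bi ij).
Qed.

(** Below, wF and wM are the numbers of slots on pairs inside and outside F, and every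
    pair carries between q and q + 4 slots. *)
Variables (mu k q wF wM : nat) (F : {set {set V}}).
Hypothesis F2 : F \subset ksets V 2.
Hypothesis mu_gt0 : 0 < mu.
Hypothesis total : wF + wM = mu * 'C(n, k).
Hypothesis wF_le : wF <= (q + 4) * #|F|.
Hypothesis wM_ge : q * #|ksets V 2 :\: F| <= wM.
Hypothesis q_le : q * 'C(n, 2) <= mu * 'C(n, k).
Hypothesis q_ge : mu * 'C(n, k) <= (q + 4) * 'C(n, 2).

Let M := ksets V 2 :\: F.
Let M2 : M \subset ksets V 2. Proof. exact: subsetDl. Qed.
Let FM : #|F| + #|M| = 'C(n, 2).
Proof. by rewrite -card_ksets -(cardsID F (ksets V 2)) (setIidPr F2). Qed.
Let HU : #|hits k F| + #|cliques k M| = 'C(n, k).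
Proof. exact: hits_cliques. Qed.

(** Hall's condition seen from the complement: slots and edges being equally many,
    it says that the edges missed by F are no more than the slots on M. *)
Let enough : mu * #|cliques k M| <= wM -> wF <= mu * #|hits k F|.
Proof. by move: total; rewrite -HU mulnDr; lia. Qed.

Lemma enough_hits_triple : k = 3 -> 108 <= n -> wF <= mu * #|hits k F|.
Proof.
move=> k3 n108; subst k.
have C3 : 'C(n, 3) * 3 = 'C(n, 2) * (n - 2) by have := @bin_bin 2 3 isT; rewrite bin1.
have C2 : 'C(n, 2) * 2 = n * (n - 1) by exact: bin2_double.
have E0 : 0 < 'C(n, 2) by nia.
have q1 : mu * (n - 2) <= 3 * (q + 4).
  rewrite -(leq_pmul2l E0); move: q_ge; nia.
have q2 : 3 * q <= mu * (n - 2).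
  rewrite -(leq_pmul2l E0); move: q_le; nia.
have [Msmall|Mbig] := leqP #|M| (2 * (n - 16)./2 ^ 2).
  apply: enough; apply: leq_trans wM_ge.
  exact: sparse_triangles_arith mu_gt0 n108 q1 (three_cliques Msmall M2).
have Fsmall : #|F| <= 2 * (n - 26)./2 ^ 2.
  by apply: (dense_triangles_arith n108 _ Mbig); rewrite FM.
have H : #|F| * (n - 2) <= 2 * #|hits 3 F| + #|cliques 3 F|.
  by have := hits_lower F2 (isT : 2 <= 3); rewrite bin1.
exact: triangle_hits_arith mu_gt0 n108 q2 wF_le H (three_cliques Fsmall F2).
Qed.

(** Averaging transfers the bounds on 4-cliques to k-cliques in both alternatives: the
    density of k-cliques in M is at most that of 4-cliques, and so F hits k-sets at
    least as densely as it hits 4-sets. *)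
Lemma enough_hits_middle : 38 <= n -> 4 <= k <= n - 4 -> wF <= mu * #|hits k F|.
Proof.
move=> n38 /andP[k4 kn].
have C4 : 'C(n, 4) * 6 = 'C(n, 2) * 'C(n - 2, 2) by have := @bin_bin 2 4 isT.
have C2 : 'C(n, 2) * 2 = n * (n - 1) by exact: bin2_double.
have c2 : 'C(n - 2, 2) * 2 = (n - 2) * (n - 3) by rewrite bin2_double -subnDA.
set c := 'C(n - 2, 2) in C4 c2 *.
have C40 : 0 < 'C(n, 4) by rewrite bin_gt0; lia.
have NC4 : 'C(n, 4) <= mu * 'C(n, k).
  by apply: leq_trans (leq_pmull _ mu_gt0); apply: leq_bin_middle; lia.
have avg : #|cliques k M| * 'C(n, 4) <= #|cliques 4 M| * 'C(n, k).
  have k40 : 0 < 'C(k, 4) by rewrite bin_gt0.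
  rewrite -(leq_pmul2r k40) mulnAC -[leqRHS]mulnA bin_bin // mulnCA [leqRHS]mulnC.
  by rewrite leq_mul2r cliques_average ?orbT.
have [Msmall|Mbig] := leqP (#|M| + 24) c.
  apply: enough; apply: leq_trans wM_ge; rewrite -(leq_pmul2r C40).
  apply: leq_trans (sparse_four_cliques_arith C40 C4 NC4 q_ge (four_cliques M) Msmall).
  by rewrite -mulnA [leqRHS]mulnCA leq_mul2l avg orbT.
have Fsmall : #|F| + 120 <= c.
  have e1 : n * (n - 1) = (n - 2) * (n - 3) + (4 * n - 6) by clear -n38; nia.
  have e2 : 35 * (n - 2) <= (n - 2) * (n - 3).
    by rewrite mulnC leq_mul2l; clear -n38; apply/orP; right; lia.
  by clear -FM C2 c2 e1 e2 Mbig n38; lia.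
have hk : #|hits 4 F| * 'C(n, k) <= #|hits k F| * 'C(n, 4).
  have := hits_cliques 4 F2; rewrite -/M => HU4.
  have := leqnn ('C(n, 4) * 'C(n, k)); rewrite -{1}HU4 -{2}HU !mulnDl !mulnDr.
  by clear -avg; rewrite (mulnC _ #|hits k F|) (mulnC _ #|cliques k M|); lia.
have H5 : #|F| * c <= 5 * #|hits 4 F| + #|cliques 4 F| := hits_lower F2 (isT : 2 <= 4).
rewrite -(leq_pmul2r C40).
apply: leq_trans (four_hits_arith C40 C4 NC4 q_le wF_le H5 (four_cliques F) Fsmall) _.
by rewrite -!mulnA leq_mul2l mulnC hk orbT.
Qed.

(** A k-clique A in M keeps F away from all pairs inside A, so |F| is only linear in n;
    on the other hand one pair of F already hits C(n - 2, n - k) sets. *)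
Lemma enough_hits_high : 38 <= n -> n = k + 2 \/ n = k + 3 -> wF <= mu * #|hits k F|.
Proof.
move=> n38 nk.
have [/eqP U0|] := boolP (#|cliques k M| == 0).
  by apply: enough; rewrite U0 muln0.
rewrite cards_eq0 => /set0Pn[A]; rewrite !inE => /andP[/eqP Ak /cliqueP cA].
have [F0|] := eqVneq #|F| 0; first by move: wF_le; rewrite F0; lia.
rewrite cards_eq0 => /set0Pn[g gF].
have Mk : 'C(k, 2) <= #|M|.
  rewrite -Ak -card_subsets; apply/subset_leq_card/subsetP => f.
  by rewrite inE => /andP[]; rewrite inE => /eqP f2 fA; apply: cA.
have H : 'C(n - 2, k - 2) <= #|hits k F|.
  rewrite -(card_supersets (subsetP F2 g gF)); last by lia.
  apply/subset_leq_card/subsetP => B; rewrite !inE => /andP[-> gB] /=.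
  by apply/exists_inP; exists g.
have FMk : 2 * #|F| + 'C(k, 2) * 2 <= n * (n - 1).
  by rewrite -bin2_double -FM mulnDl mulnC leq_add2l leq_mul2r Mk orbT.
have E0 : 0 < 'C(n, 2) by rewrite bin_gt0; lia.
have C3 : 'C(n, 3) * 3 = 'C(n, 2) * (n - 2) by have := @bin_bin 2 3 isT; rewrite bin1.
have qle := q_le; rewrite -(@bin_sub n k) in qle; last by clear -nk; lia.
rewrite -(@bin_sub (n - 2) (k - 2)) in H; last by clear -nk; lia.
rewrite bin2_double in FMk.
have [m nE] : exists m, n = m + 38 by exists (n - 38); clear -n38; lia.
case: nk => nk.
  have qmu : q <= mu.
    by rewrite -(leq_pmul2r E0); move: qle; have -> : n - k = 2 by clear -nk; lia.
  have {}H : (m + 36) * (m + 35) <= 2 * #|hits k F|.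
    have -> : (m + 36) * (m + 35) = 2 * 'C(n - 2, 2).
      by rewrite [RHS]mulnC bin2_double; congr (_ * _); clear -nE; lia.
    rewrite leq_mul2l; apply: leq_trans H.
    by have -> : n - 2 - (k - 2) = 2 by clear -nk n38; lia.
  apply: codim2_arith mu_gt0 qmu wF_le _ H.
  move: FMk; rewrite nE.
  have -> : k = m + 36 by clear -nk nE; lia.
  by rewrite -!addnBA.
have hq : 3 * q <= mu * (m + 36).
  have -> : m + 36 = n - 2 by clear -nE; lia.
  have nk3 : n - k = 3 by clear -nk; lia.
  rewrite nk3 in qle.
  rewrite -(leq_pmul2l E0); move: qle => qC.
  have := leq_mul qC (leqnn 3); rewrite -[leqRHS]mulnA C3 [leqRHS]mulnCA.
  by rewrite [q * _]mulnC -[leqLHS]mulnA [q * 3]mulnC.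
have {}H : (m + 36) * ((m + 35) * (m + 34)) <= 6 * #|hits k F|.
  have -> : (m + 36) * ((m + 35) * (m + 34)) = 6 * 'C(n - 2, 3).
    have := mul_bin_left (n - 2) 2; have := bin2_double (n - 2).
    have -> : n - 2 = m + 36 by clear -nE; lia.
    by rewrite -!addnBA //; clear; nia.
  rewrite leq_mul2l; apply: leq_trans H.
  by have -> : n - 2 - (k - 2) = 3 by clear -nk n38; lia.
apply: codim3_arith mu_gt0 hq wF_le _ H.
move: FMk; rewrite nE.
have -> : k = m + 35 by clear -nk nE; lia.
by rewrite -!addnBA.
Qed.
End Counting.

(** * From matched slots to a decomposition *)

(** The last edge of a cycle of length l returns to position 0. *)
Definition next_index (cl : bool) (l p : nat) : nat := if cl then p.+1 %% l else p.+1.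

Lemma ltn_next_index cl l p : p < l -> next_index cl l p < l + ~~ cl.
Proof.
rewrite /next_index; case: cl => /= pl; last by rewrite addn1 ltnS.
by rewrite addn0 ltn_mod; apply: leq_trans pl.
Qed.

Section ItemSum.
Import GRing.Theory.
Local Open Scope ring_scope.
(** Here l is the number of edges; a path has one vertex more. *)
Lemma item_sum_nth (V : finType) (g : V -> V -> int) cl x0 s l :
  size s = (l + ~~ cl)%N -> (0 < l)%N ->
  item_sum g cl s = \sum_(p < l) g (nth x0 s p) (nth x0 s (next_index cl l p)).
Proof.
have W x s' : walk_sum g x s' =
    \sum_(p < size s') g (nth x0 (x :: s') p) (nth x0 (x :: s') p.+1).
  by elim: s' x => [|y s' IH] x; rewrite ?big_ord0 // big_ord_recl /= IH.
case: s => [|x s]; first by case: l.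
rewrite /item_sum W /next_index; case: cl => /= [|]; last first.
  by rewrite addn1 addr0 => -[<-] _.
rewrite addn0 => <- _; rewrite big_ord_recr /= modnn; congr (_ + g _ _).
  by apply: eq_bigr => p _; rewrite modn_small // ltnS.
exact: last_nth.
Qed.
End ItemSum.

Lemma set2_eq (V : finType) (x y u v : V) : x != y ->
  ([set u; v] == [set x; y]) = (u == x) && (v == y) || (u == y) && (v == x).
Proof.
move=> xy; apply/eqP/orP => [E|[] /andP[/eqP-> /eqP->] //]; last exact: setUC.
move/setP: E => E; have yx := xy; rewrite eq_sym in yx.
move: (E v) (E u) (E y) (E x); rewrite !inE !eqxx ?orbT /=.
move=> /esym/orP[] /eqP-> /esym/orP[] /eqP->;
  by rewrite ?eqxx ?(negPf xy) ?(negPf yx) //=; auto.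
Qed.

Section Assembly.
Import GRing.Theory.
Variables (H : mhypergraph) (s t : nat) (C : s.-tuple nat) (P : t.-tuple nat).

Definition item_len (i : 'I_s + 'I_t) : nat :=
  match i with inl a => tnth C a | inr b => tnth P b end.

Definition cyclic (i : 'I_s + 'I_t) : bool := if i is inl _ then true else false.

Definition slot := {i : 'I_s + 'I_t & 'I_(item_len i)}.

Definition enter (x0 : vertex H) cfg (e : slot) := nth x0 (cfg (tag e)) (tagged e).
Definition leave (x0 : vertex H) cfg (e : slot) :=
  nth x0 (cfg (tag e)) (next_index (cyclic (tag e)) (item_len (tag e)) (tagged e)).

Lemma card_slot : #|{: slot}| = \sum_i tnth C i + \sum_j tnth P j.
Proof.
rewrite card_tagged sumnE big_map big_enum /= big_sumType /=.
by congr (_ + _); apply: eq_bigr => i _; rewrite card_ord.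
Qed.

(** The slots being as many as the edges, an injective filling uses every edge. *)
Lemma assemble (x0 : vertex H) (cfg : 'I_s + 'I_t -> seq (vertex H)) (g : slot -> edge H) :
  placement (fun i => item_len i + ~~ cyclic i) cfg ->
  injective g -> #|edge H| = #|{: slot}| ->
  (forall e, enter x0 cfg e \in ends (g e)) ->
  (forall e, leave x0 cfg e \in ends (g e)) ->
  has_berge_decomposition H C P.
Proof.
move=> pl g_inj gN gl gr.
pose sl i (p : 'I_(item_len i)) : slot := Tagged (fun i => 'I_(item_len i)) p.
have sl_inj i : injective (@sl i) by move=> p q /eqP; rewrite eq_Tagged => /eqP.
have nth_inj i p q : p < item_len i + ~~ cyclic i -> q < item_len i + ~~ cyclic i ->
    nth x0 (cfg i) p = nth x0 (cfg i) q -> p = q.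
  have [us ss] := pl i => pl' ql' /eqP; rewrite nth_uniq ?ss // => /eqP.
  by [].
have edge_inj i : injective (fun p => g (sl i p)) by move=> p q /g_inj/sl_inj.
have cyc_inj (i : 'I_s) : injective (fun p : 'I_(tnth C i) => nth x0 (cfg (inl i)) p).
  by move=> p q /nth_inj E; apply/val_inj/E; rewrite addn0.
have path_inj (j : 'I_t) : injective (fun p : 'I_(tnth P j).+1 => nth x0 (cfg (inr j)) p).
  by move=> p q /nth_inj E; apply/val_inj/E; rewrite addn1.
pose cyc (i : 'I_s) : berge_cycle H (tnth C i) :=
  BergeCycle (@cyc_inj i) (@edge_inj (inl i)) (fun p => gl (sl (inl i) p))
    (fun p => gr (sl (inl i) p)).
pose pth (j : 'I_t) : berge_path H (tnth P j) :=
  BergePath (@path_inj j) (@edge_inj (inr j)) (fun p => gl (sl (inr j) p))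
    (fun p => gr (sl (inr j) p)).
exists cyc, pth.
pose D x := match x with inl i => bc_edges (cyc i) | inr j => bp_edges (pth j) end.
have DE x : D x = [set g (sl x p) | p : 'I_(item_len x)] by case: x.
rewrite /= -/D.
split=> [x y xy|].
  rewrite -/(D x) -/(D y) !DE -setI_eq0; apply/eqP/setP => e; rewrite !inE.
  apply/negP => /andP[/imsetP[p _ ->] /imsetP[q _ /g_inj/(congr1 tag)/= E]].
  by rewrite E eqxx in xy.
apply/setP => e; rewrite inE; have /codomP[[x p] ->] : e \in codom g.
  by apply: inj_card_onto => //; rewrite gN.
by apply/bigcupP; exists x => //; rewrite -/(D x) DE; apply/imsetP; exists p.
Qed.

Variables (x0 : vertex H) (cfg : 'I_s + 'I_t -> seq (vertex H)).
Hypothesis cfgP : placement (fun i => item_len i + ~~ cyclic i) cfg.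
Hypothesis item_len_gt0 : forall i, 0 < item_len i.
Hypothesis item_len_gt1 : forall i, cyclic i -> 1 < item_len i.

Definition slot_pair (e : slot) : {set vertex H} := [set enter x0 cfg e; leave x0 cfg e].

Lemma enter_leave e : enter x0 cfg e != leave x0 cfg e.
Proof.
case: e => i p; rewrite /enter /leave /=; have [us ss] := cfgP i.
rewrite nth_uniq ?ss ?ltn_next_index //; last by apply: leq_trans (leq_addr _ _).
rewrite /next_index; case ci: (cyclic i); last by rewrite neq_ltn ltnSn.
have := ltn_ord p; rewrite leq_eqVlt => /predU1P[E|lt].
  by rewrite E modnn; apply/eqP => p0; move: (item_len_gt1 ci); rewrite -E p0.
by rewrite modn_small // neq_ltn ltnSn.
Qed.

Lemma slot_pair2 e : slot_pair e \in ksets (vertex H) 2.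
Proof. by rewrite inE cards2 enter_leave. Qed.

Lemma load_card x y : x != y ->
  load cyclic cfg x y = (#|[set e | slot_pair e == [set x; y]]|%:R)%R.
Proof.
move=> xy; rewrite -sum1dep_card natr_sum big_mkcond /=.
have E i : mult (cyclic i) (cfg i) x y =
    (\sum_(p < item_len i) if slot_pair (existT _ i p) == [set x; y] then 1 else 0)%R.
  rewrite /mult (item_sum_nth _ x0 (cfgP i).2 (item_len_gt0 i)).
  apply: eq_bigr => p _; rewrite set2_eq // /enter /leave /= /joins.
  move: (nth _ _ _) (nth _ _ _) => v u.
  case: (eqVneq u x) => [->|_] /=; last by rewrite mulr0n add0r; case: (_ && _).
  by rewrite (negPf xy) /= orbF mulr0n addr0; case: (_ == _).
rewrite /load (eq_bigr _ (fun i _ => E i)).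
by rewrite sig_big_dep; apply: eq_bigr => -[].
Qed.
End Assembly.

(** * Matching slots and edges *)

Section Complete.
Variables (mu n k s t : nat) (C : s.-tuple nat) (P : t.-tuple nat).
Hypothesis n_gt1 : 1 < n.
Hypothesis hC : forall i : 'I_s, 2 <= tnth C i <= n.
Hypothesis hP : forall j : 'I_t, 1 <= tnth P j <= n - 1.
Hypothesis hsum :
  \sum_(i < s) tnth C i + \sum_(j < t) tnth P j = mu * 'C(n, k).

Local Notation H := (complete_mhypergraph mu n k).
Local Notation item_len := (item_len C P).

Lemma item_len_gt0 i : 0 < item_len i.
Proof. by case: i => i /=; [have := hC i | have := hP i]; case: (tnth _ _). Qed.

Lemma item_len_gt1 i : cyclic i -> 1 < item_len i.
Proof. by case: i => i //= _; have /andP[] := hC i. Qed.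

Lemma item_fits i : item_len i + ~~ cyclic i <= n.
Proof using hC hP. case: i => i /=; [move: (hC i) | move: (hP i)]; move: (tnth _ _) => m; clear; lia. Qed.

Lemma card_edges : #|edge H| = mu * 'C(n, k).
Proof.
rewrite card_prod card_ord card_sig; congr (_ * _).
by rewrite -[n in RHS]card_ord -card_ksets; apply: eq_card => A; rewrite !inE.
Qed.

Lemma card_slots : #|{: slot C P}| = #|edge H|.
Proof. by rewrite card_slot hsum card_edges. Qed.

Definition enough_hits := forall (q wF wM : nat) (F : {set {set 'I_n}}),
  F \subset ksets 'I_n 2 -> wF + wM = mu * 'C(n, k) ->
  wF <= (q + 4) * #|F| -> q * #|ksets 'I_n 2 :\: F| <= wM ->
  q * 'C(n, 2) <= mu * 'C(n, k) -> mu * 'C(n, k) <= (q + 4) * 'C(n, 2) ->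
  wF <= mu * #|hits k F|.

(** Any placement can serve as the starting point of the descent; all items start at
    vertex 0 here. *)
Lemma near_uniform_placement : exists cfg : 'I_s + 'I_t -> seq 'I_n, exists q : nat,
  placement (fun i => item_len i + ~~ cyclic i) cfg /\
  forall x0 (f : {set 'I_n}), #|f| = 2 ->
    q <= #|[set e | @slot_pair H s t C P x0 cfg e == f]| <= q + 4.
Proof.
pose cfg0 (i : 'I_s + 'I_t) := take (item_len i + ~~ cyclic i) (enum 'I_n).
have pl0 : placement (fun i => item_len i + ~~ cyclic i) cfg0.
  move=> i; split; first by rewrite take_uniq // enum_uniq.
  by rewrite size_takel // size_enum_ord item_fits.
have [cfg pl bal] := balanced_placement (@cyclic s t) pl0.
pose w (f : {set 'I_n}) x0 := #|[set e | @slot_pair H s t C P x0 cfg e == f]|.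
pose x1 : 'I_n := Ordinal (ltnW n_gt1); pose y1 : 'I_n := Ordinal n_gt1.
have wE x0 (x y : 'I_n) : x != y -> load (@cyclic s t) cfg x y = Posz (w [set x; y] x0).
  rewrite -natz; exact: (@load_card H _ _ _ _ x0 cfg pl item_len_gt0).
pose p1 : 'I_n * 'I_n := (x1, y1).
have x1y1 : p1.1 != p1.2 by [].
case: (arg_minnP (P := fun p : 'I_n * 'I_n => p.1 != p.2) (fun p => w [set p.1; p.2] x1) x1y1).
move=> [x y] /= xy min; exists cfg, (w [set x; y] x1); split=> // x0 f f2.
have /cards2P[u [v [uv ->]]] : #|f| == 2 by apply/eqP.
have wx0 : w [set u; v] x0 = w [set u; v] x1.
  by have := wE x0 _ _ uv; rewrite (wE x1) // => -[->].
rewrite -/(w _ x0) wx0 (min (u, v)) //=.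
by have := bal u v x y uv xy; rewrite !(wE x1).
Qed.

(** For a set S of slots, F is the set of their pairs; the edges adjacent to S are the
    mu copies of the k-sets that F hits. *)
Lemma decomposition_of_hits : enough_hits -> has_berge_decomposition H C P.
Proof.
move=> enough; have [cfg [q [pl qw]]] := near_uniform_placement.
pose x0 : 'I_n := Ordinal (ltnW n_gt1).
pose sp := @slot_pair H s t C P x0 cfg.
have sp2 e : sp e \in ksets 'I_n 2.
  exact: (@slot_pair2 H _ _ _ _ x0 cfg pl item_len_gt1).
have fiber (G : {set {set 'I_n}}) : #|[set e | sp e \in G]| =
    \sum_(f in G) #|[set e | sp e == f]|.
  rewrite -sum1dep_card (partition_big sp (mem G)) //=; apply: eq_bigr => f fG.
  rewrite sum1dep_card; apply: eq_card => e; rewrite !inE.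
  by case: eqP => [->|]; rewrite ?fG ?andbF.
pose nb e : {set edge H} := [set d : edge H | sp e \subset ends d].
have [|g [g_inj gP]] := @hall _ _ nb.
  move=> S; pose F := [set sp e | e in S].
  have F2 : F \subset ksets 'I_n 2 by apply/subsetP => _ /imsetP[e _ ->].
  apply: (@leq_trans #|[set e | sp e \in F]|).
    by apply/subset_leq_card/subsetP => e eS; rewrite inE; apply: imset_f.
  have lo (G : {set {set 'I_n}}) : G \subset ksets 'I_n 2 -> q * #|G| <= #|[set e | sp e \in G]|.
    move=> /subsetP G2; rewrite fiber mulnC -sum_nat_const; apply: leq_sum => f /G2.
    by rewrite inE => /eqP f2; have /andP[] := qw x0 f f2.
  have hi (G : {set {set 'I_n}}) : G \subset ksets 'I_n 2 -> #|[set e | sp e \in G]| <= (q + 4) * #|G|.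
    move=> /subsetP G2; rewrite fiber mulnC -sum_nat_const; apply: leq_sum => f /G2.
    by rewrite inE => /eqP f2; have /andP[] := qw x0 f f2.
  have all2 : #|[set e | sp e \in ksets 'I_n 2]| = mu * 'C(n, k).
    rewrite -card_edges -card_slots -cardsT; apply: eq_card => e.
    by rewrite in_setT inE sp2.
  have k2 : #|ksets 'I_n 2| = 'C(n, 2) by rewrite card_ksets card_ord.
  apply: leq_trans (enough q _ #|[set e | sp e \in ksets 'I_n 2 :\: F]| F F2 _ _ _ _ _) _.
  - rewrite -all2 -(cardsID [set e | sp e \in F] [set e | sp e \in ksets 'I_n 2]).
    congr (_ + _); apply: eq_card => e; rewrite !inE -/(sp e).
      by have := sp2 e; rewrite inE => ->.
    by rewrite andbC.
  - exact: hi.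
  - by apply: lo; apply: subsetDl.
  - by rewrite -k2 -all2; apply: lo.
  - by rewrite -k2 -all2; apply: hi.
  pose val_pair (d : edge H) : 'I_mu * {set 'I_n} := (d.1, val d.2).
  rewrite -{1}[mu]card_ord -cardsT -cardsX.
  apply: leq_trans (leq_imset_card val_pair _).
  apply/subset_leq_card/subsetP => -[c A]; rewrite !inE /= => /andP[Ak].
  case/exists_inP => f /imsetP[e eS ->] eA.
  apply/imsetP; exists (c, exist _ A Ak) => //.
  by apply/bigcupP; exists e => //; rewrite inE.
apply: (@assemble H s t C P x0 cfg g pl g_inj).
- by rewrite card_slots.
- by move=> e; have := gP e; rewrite inE subUset !sub1set => /andP[].
- by move=> e; have := gP e; rewrite inE subUset !sub1set => /andP[].
Qed.
End Complete.

(** * The case k = n - 1 and the theorem *)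

(** The intervals are laid end to end, in the order of enum_rank. *)
Lemma consecutive_blocks (I : finType) (sz : I -> nat) :
  exists off : I -> nat,
    (forall i, off i + sz i <= \sum_j sz j) /\
    (forall i j p r, p < sz i -> r < sz j -> off i + p = off j + r -> i = j).
Proof.
pose off (i : I) := \sum_(j | enum_rank j < enum_rank i) sz j.
have offS i j : enum_rank i < enum_rank j -> off i + sz i <= off j.
  move=> ij; rewrite {2}/off (bigD1 i) //= addnC leq_add2l.
  rewrite [leqRHS](bigID (fun l => enum_rank l < enum_rank i)) /=.
  apply: leq_trans (leq_addr _ _); apply: eq_leq; apply: eq_bigl => l.
  case: (ltnP (enum_rank l) (enum_rank i)) => li; rewrite ?andbF // andbT.
  by rewrite (ltn_trans li ij); apply/esym; apply: contraTneq li => ->; rewrite ltnn.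
exists off; split=> [i|i j p r pi rj E].
  rewrite [leqRHS](bigID (fun l => enum_rank l < enum_rank i)) /= leq_add2l.
  by rewrite (bigD1 i) ?ltnn //= leq_addr.
case: (ltngtP (enum_rank i) (enum_rank j)) => [/offS|/offS|/val_inj/enum_rank_inj//]; lia.
Qed.

Section Corank1.
Variables (mu n s t : nat) (C : s.-tuple nat) (P : t.-tuple nat).
Hypothesis n_gt3 : 3 < n.
Hypothesis hC : forall i : 'I_s, 2 <= tnth C i <= n.
Hypothesis hP : forall j : 'I_t, 1 <= tnth P j <= n - 1.
Hypothesis hsum :
  \sum_(i < s) tnth C i + \sum_(j < t) tnth P j = mu * 'C(n, n - 1).

Local Notation H := (complete_mhypergraph mu n (n - 1)).
Local Notation item_len := (item_len C P).

(** List the edges cyclically by their missing vertex 0, 1, ..., n - 1, with one copy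
    of each in every round, and give item i the block of edges starting at off i.
    The edge at position m misses vertex m mod n, so running through the vertices m + c
    with 0 < c < c + 1 < n keeps both ends of each edge clear of the missing vertex.
    The closing edge of a cycle of length l, at position off i + l - 1, must contain
    the first vertex off i + c, which excludes c = l - 1; hence c = 2, or c = 1 when
    l = 3. *)
Lemma decomposition_corank1 : has_berge_decomposition H C P.
Proof.
have n0 : 0 < n by apply: leq_trans n_gt3.
have [off [off_le off_inj]] := consecutive_blocks item_len.
pose o m : 'I_n := Ordinal (ltn_pmod m n0).
pose shift (i : 'I_s + 'I_t) := if item_len i == 3 then 1 else 2.
pose cfg (i : 'I_s + 'I_t) : seq 'I_n :=
  [seq o (off i + shift i + p) | p <- iota 0 (item_len i + ~~ cyclic i)].
have o_inj a p r : p < n -> r < n -> o (a + p) = o (a + r) -> p = r.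
  move=> pn rn /(congr1 val)/= /eqP; rewrite eqn_modDl !modn_small // => /eqP.
  by [].
have fits i : item_len i + ~~ cyclic i <= n := item_fits hC hP i.
have cfg_nth i p : p < item_len i + ~~ cyclic i -> nth (o 0) (cfg i) p = o (off i + shift i + p).
  by move=> pl; rewrite (nth_map 0) ?size_iota // nth_iota.
have pl : placement (fun i => item_len i + ~~ cyclic i) cfg.
  move=> i; rewrite size_map size_iota; split=> //.
  rewrite map_inj_in_uniq ?iota_uniq // => p r; rewrite !mem_iota /= => pl rl.
  by apply: o_inj; apply: leq_trans (fits i).
have total : \sum_i item_len i = mu * n.
  rewrite big_sumType /= hsum; congr (_ * _).
  by rewrite -bin_sub ?subKn ?bin1 // leq_subr.
have idx_lt (e : slot C P) : off (tag e) + tagged e < mu * n.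
  by rewrite -total; apply: leq_trans (off_le (tag e)); rewrite -addnS leq_add2l.
have copy_lt (e : slot C P) : (off (tag e) + tagged e) %/ n < mu by rewrite ltn_divLR.
have cardk (m : nat) : #|[set~ o m]| == n - 1 by rewrite cardsC1 card_ord subn1.
pose g (e : slot C P) : edge H :=
  (Ordinal (copy_lt e), exist _ [set~ o (off (tag e) + tagged e)] (cardk _)).
have g_inj : injective g.
  move=> [i p] [j r] E.
  have E1 : (off i + p) %/ n = (off j + r) %/ n by case: E.
  have E2 : (off i + p) %% n = (off j + r) %% n.
    have := congr1 (fun d : edge H => val d.2) E => /= /setC_inj/set1_inj.
    by move/(congr1 val).
  have E3 : off i + p = off j + r.
    by rewrite (divn_eq (off i + p) n) E1 E2 -divn_eq.
  have ij := off_inj i j p r (ltn_ord p) (ltn_ord r) E3.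
  subst j; congr existT; apply: val_inj.
  by move/eqP: E3; rewrite eqn_add2l => /eqP.
have avoids a c : 0 < c < n -> o (a + c) \in [set~ o a].
  move=> /andP[c0 cn]; rewrite !inE; apply/eqP; rewrite -{2}[a]addn0 => /o_inj.
  by move=> /(_ cn n0) c00; rewrite c00 in c0.
have shift_lt i : 0 < shift i < 3 by rewrite /shift; case: ifP.
apply: (@assemble H s t C P (o 0) cfg g pl g_inj).
- exact/esym/(card_slots hsum).
- move=> [i p]; rewrite /enter /= cfg_nth; last by apply: leq_trans (leq_addr _ _).
  by rewrite addnAC; apply: avoids; have := shift_lt i; lia.
move=> [i p]; rewrite /leave /= cfg_nth ?ltn_next_index //.
have [->|[ci pE ->]] : next_index (cyclic i) (item_len i) p = p.+1 \/
    [/\ cyclic i, p.+1 = item_len i & next_index (cyclic i) (item_len i) p = 0].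
- rewrite /next_index; case ci: (cyclic i); last by left.
  have := ltn_ord p; rewrite leq_eqVlt => /predU1P[E|lt]; last by left; rewrite modn_small.
  by right; rewrite E modnn.
- have -> : off i + shift i + p.+1 = off i + p + (shift i).+1 by lia.
  by apply: avoids; have := shift_lt i; lia.
rewrite addn0 !inE; apply/eqP => /o_inj sp.
have pn : p < n by have := fits i; have := ltn_ord p; lia.
have {}sp : shift i = p by apply: sp => //; have := shift_lt i; lia.
by move: (nat_of_ord p) pE sp => r rE; rewrite /shift -rE; case: r {rE} => [|[|[|r]]].
Qed.
End Corank1.

Theorem theorem1p5 (mu k n : nat)
    (mu_gt0 : 0 < mu) (k_ge3 : 3 <= k) (k_lt_n : k < n)
    (n_k3 : k = 3 -> 108 <= n)
    (n_k4 : k = 4 -> 54 <= n)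
    (n_k5 : 5 <= k -> 38 <= n)
    (s t : nat) (C : s.-tuple nat) (P : t.-tuple nat)
    (hC : forall i : 'I_s, 2 <= tnth C i <= n)
    (hP : forall j : 'I_t, 1 <= tnth P j <= n - 1)
    (hsum : \sum_(i < s) tnth C i + \sum_(j < t) tnth P j = mu * 'C(n, k)) :
  has_berge_decomposition (complete_mhypergraph mu n k) C P.
Proof.
have n38 : 38 <= n by lia.
have [kE|kn1] := eqVneq k (n - 1).
  by rewrite kE in hsum *; apply: decomposition_corank1 => //; lia.
apply: decomposition_of_hits => //; first by lia.
move=> q wF wM F F2 tot hF hM qle qge.
have VE : #|'I_n| = n := card_ord n.
have [k3|k3] := eqVneq k 3.
  by apply: (@enough_hits_triple 'I_n mu k q wF wM F) => //; rewrite ?VE //; apply: n_k3.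
have [k4|k4] := leqP k (n - 4).
  by apply: (@enough_hits_middle 'I_n mu k q wF wM F) => //; rewrite ?VE //; lia.
by apply: (@enough_hits_high 'I_n mu k q wF wM F) => //; rewrite ?VE //; lia.
Qed.
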